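(* Given a stopping one-player tree-like rotor game on a simple graph with vertex set $V$ and with binary sink values ($\mathrm{val}(s)\in\{0,1\}$ for every sink $s$), the optimal values $\mathrm{val}^*(u)$ of all vertices $u\in V$ can be computed in (total) time complexity $O(|V|)$.
   Context: A directed graph $(V,\mathcal{A},h,t)$ has a finite vertex set $V$, a finite arc set $\mathcal{A}$, and maps $h,t:\mathcal{A}\to V$ (head, tail), with no loops. $\mathcal{A}^+(u)$ is the set of arcs with tail $u$. It is simple if for every $u,v$ there is at most one arc with tail $u$ and head $v$. $\overline{G}$ is the simple undirected graph on $V$ in which $u,v$ are adjacent iff some arc joins them in either direction. Rotor graph $(V_0,S_0,\mathcal{A},h,t,\theta)$: $V=V_0\sqcup S_0$ with $S_0\neq\emptyset$ (the sinks), and for each $u\in V_0$ a rotor order $\theta_u:\mathcal{A}^+(u)\to\mathcal{A}^+(u)$ such that the orbit of every arc is all of $\mathcal{A}^+(u)$. A rotor configuration is a map $\rho:V_0\to\mathcal{A}$ with $\rho(u)\in\mathcal{A}^+(u)$; a partial configuration on $V'\subseteq V_0$ is such a map defined on $V'$ only. One routing step from $(\rho,u)$, $u\in V_0$: the particle moves from $u$ to $h(\rho(u))$, and then $\rho(u)$ is replaced by $\theta_u(\rho(u))$. The maximal rotor walk iterates routing steps until a sink is reached. The rotor graph is stopping if from every vertex there is a directed path to a sink (then all rotor walks are finite). It is tree-like if $\overline{G}$ is a tree and every sink is a leaf of $\overline{G}$. One-player tree-like rotor game $(V_r,V_{\mathcal{MAX}},S_0,\mathcal{A},h,t,\theta,\mathrm{val},\rho)$: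 $V_r,V_{\mathcal{MAX}},S_0$ are disjoint, $(V_0,S_0,\mathcal{A},h,t,\theta)$ with $V_0=V_r\cup V_{\mathcal{MAX}}$ is a tree-like rotor graph, $\mathrm{val}:S_0\to\mathbb{N}$, and $\rho$ is a partial configuration on $V_r$. It is stopping if the rotor graph is. A strategy $\sigma$ is a partial configuration on $V_{\mathcal{MAX}}$. For a starting vertex $u$, $\mathrm{val}_\sigma(u)=\mathrm{val}(s)$ where $s$ is the sink reached by the maximal rotor walk from $((\rho,\sigma),u)$, and $\mathrm{val}^*(u)=\max_\sigma\mathrm{val}_\sigma(u)$ (the optimal strategy may depend on $u$). Time is counted in elementary operations (arithmetic operations and comparisons at unit cost). *)

(* Defs.v *)
From mathcomp Require Import all_boot.

Set Implicit Arguments.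
Unset Strict Implicit.
Unset Printing Implicit Defensive.

(** * Directed graphs *)

Record digraph := Digraph {
  vertex : finType;
  arcs : finType;
  arc_head : arcs -> vertex;
  arc_tail : arcs -> vertex;
  arc_loopless : forall a, arc_head a != arc_tail a }.

Section Digraph.
Variable G : digraph.
Implicit Types u v : vertex G.

Definition simple_digraph := forall a b : arcs G,
  arc_tail a = arc_tail b -> arc_head a = arc_head b -> a = b.

Definition arc_rel : rel (vertex G) := fun u v =>
  [exists a : arcs G, (arc_tail a == u) && (arc_head a == v)].

(** Edge relation of the underlying simple undirected graph. *)
Definition adj : rel (vertex G) := fun u v => arc_rel u v || arc_rel v u.

(** [ucycle adj c] also holds for the sequences [u; v] that traverse one edge
    back and forth; genuine cycles of a simple graph have length at least 3. *)
Definition underlying_tree :=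
  (forall u v, connect adj u v) /\
  (forall c : seq (vertex G), ucycle adj c -> size c < 3).

Definition underlying_leaf u := #|[set v | adj u v]| = 1.

End Digraph.

(** * Rotor graphs *)

(** [theta] gathers all the rotor orders theta_u into one map on arcs.  It is
    unconstrained on arcs leaving a sink, which no rotor walk ever uses. *)
Record rotor_graph := RotorGraph {
  rotor_digraph :> digraph;
  sinks : {set vertex rotor_digraph};
  sinks_neq0 : sinks != set0;
  theta : arcs rotor_digraph -> arcs rotor_digraph;
  theta_orbit : forall a, arc_tail a \notin sinks ->
    orbit theta a =i [pred b | arc_tail b == arc_tail a] }.

Section RotorGraph.
Variable R : rotor_graph.
Implicit Types u s : vertex R.

Definition stopping := forall u, exists2 s, s \in sinks R & connect (@arc_rel R) u s.

Definition tree_like :=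
  underlying_tree R /\ (forall s, s \in sinks R -> underlying_leaf s).

Definition config := {ffun vertex R -> option (arcs R)}.

(** [rho] is a partial configuration with domain exactly [W]. *)
Definition partial_config (W : {set vertex R}) (rho : config) := forall u,
  if rho u is Some a then u \in W /\ arc_tail a = u else u \notin W.

Definition set_rotor (rho : config) u (a : arcs R) : config :=
  [ffun v => if v == u then Some a else rho v].

(** [maximal_walk rho u s]: the maximal rotor walk from [(rho, u)] is finite
    and ends in the sink [s]. *)
Inductive maximal_walk : config -> vertex R -> vertex R -> Prop :=
| walk_stop (rho : config) s : s \in sinks R -> maximal_walk rho s s
| walk_step (rho : config) u (a : arcs R) s : u \notin sinks R -> rho u = Some a ->
    maximal_walk (set_rotor rho u (theta a)) (arc_head a) s ->
    maximal_walk rho u s.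

End RotorGraph.

(** * One-player rotor games *)

(** [value] is only meaningful on the sinks. *)
Record rotor_game := RotorGame {
  game_graph :> rotor_graph;
  Vr : {set vertex game_graph};
  Vmax : {set vertex game_graph};
  Vr_Vmax_disjoint : [disjoint Vr & Vmax];
  V0_split : Vr :|: Vmax = ~: sinks game_graph;
  value : vertex game_graph -> nat;
  rho0 : config game_graph;
  rho0_config : partial_config Vr rho0 }.

Section RotorGame.
Variable G : rotor_game.
Implicit Types (u : vertex G) (sigma : config G).

Definition binary_values :=
  forall s, s \in sinks G -> value s \in [:: 0; 1].

Definition strategy sigma := partial_config (Vmax G) sigma.

Definition join_config sigma : config G :=
  [ffun v => if v \in Vmax G then sigma v else rho0 G v].

(** [strategy_value sigma u x]: val_sigma(u) = x. *)
Definition strategy_value sigma u (x : nat) :=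
  exists2 s, maximal_walk (join_config sigma) u s & value s = x.

(** [optimal_value u x]: val^*(u) = x, the maximum over all strategies. *)
Definition optimal_value u (x : nat) :=
  (exists2 sigma, strategy sigma & strategy_value sigma u x) /\
  (forall sigma y, strategy sigma -> strategy_value sigma u y -> y <= x).

End RotorGame.

(** * A unit-cost random access machine *)

(** Structured programs over natural-number registers and arrays.  A program
    mentions finitely many of each, so the arrays could be interleaved in a
    single memory at constant cost per access.  As in the machines of Cook and
    Reckhow, the arithmetic is addition and (truncated) subtraction only: the
    omission of multiplication and division leaves fewer programs, and keeps
    unit cost from being exploited through huge integers. *)
Inductive expr :=
| Const of nat
| Reg of nat
| Cell of nat & expr           (* Cell A e is the entry of index e of array A *)
| Plus of expr & expr
| Minus of expr & expr
| IsEq of expr & expr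
| IsLeq of expr & expr.

Inductive cmd :=
| Skip
| Assign of nat & expr
| Store of nat & expr & expr   (* Store A i e writes e at index i of array A *)
| Seq of cmd & cmd
| If of expr & cmd & cmd
| While of expr & cmd.

Record state := State { reg : nat -> nat; cell : nat -> nat -> nat }.

Definition upd T (f : nat -> T) i x : nat -> T := fun j => if j == i then x else f j.

Definition set_reg s r x := State (upd (reg s) r x) (cell s).
Definition set_cell s A i x :=
  State (reg s) (upd (cell s) A (upd (cell s A) i x)).

Fixpoint eval s e : nat :=
  match e with
  | Const k => k
  | Reg r => reg s r
  | Cell A e1 => cell s A (eval s e1)
  | Plus e1 e2 => eval s e1 + eval s e2
  | Minus e1 e2 => eval s e1 - eval s e2
  | IsEq e1 e2 => eval s e1 == eval s e2
  | IsLeq e1 e2 => eval s e1 <= eval s e2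
  end.

Fixpoint cost e : nat :=
  match e with
  | Const _ | Reg _ => 1
  | Cell _ e1 => (cost e1).+1
  | Plus e1 e2 | Minus e1 e2 | IsEq e1 e2 | IsLeq e1 e2 => (cost e1 + cost e2).+1
  end.

(** [exec c s t s']: from state [s], the program [c] halts in state [s'] after
    [t] elementary operations.  Tests hold when they evaluate to a nonzero
    number. *)
Inductive exec : cmd -> state -> nat -> state -> Prop :=
| exec_skip s : exec Skip s 1 s
| exec_assign s r e : exec (Assign r e) s (cost e).+1 (set_reg s r (eval s e))
| exec_store s A i e : exec (Store A i e) s (cost i + cost e).+1
    (set_cell s A (eval s i) (eval s e))
| exec_seq c1 c2 s1 t1 s2 t2 s3 :
    exec c1 s1 t1 s2 -> exec c2 s2 t2 s3 -> exec (Seq c1 c2) s1 (t1 + t2) s3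
| exec_if e c1 c2 s t s' : exec (if eval s e != 0 then c1 else c2) s t s' ->
    exec (If e c1 c2) s (cost e + t).+1 s'
| exec_while_stop e c s : eval s e = 0 -> exec (While e c) s (cost e).+1 s
| exec_while_loop e c s1 t1 s2 t2 s3 : eval s1 e != 0 ->
    exec c s1 t1 s2 -> exec (While e c) s2 t2 s3 ->
    exec (While e c) s1 (cost e + t1 + t2).+1 s3.

(** * Encoding of games *)

(** The elements of a finite type are numbered by their rank in its
    enumeration.  As the types of vertices and arcs are arbitrary, so is the
    resulting numbering. *)
Definition table (T : finType) (f : T -> nat) : nat -> nat :=
  fun i => nth 0 (codom f) i.

Definition vertex_kind (G : rotor_game) (u : vertex G) : nat :=
  if u \in Vr G then 0 else if u \in Vmax G then 1 else 2.

Definition vertex_value (G : rotor_game) (u : vertex G) : nat :=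
  if u \in sinks G then value u else 0.

(** 0 stands for an undefined rotor and [i.+1] for the arc number [i]. *)
Definition vertex_rotor (G : rotor_game) (u : vertex G) : nat :=
  if rho0 G u is Some a then (enum_rank a).+1 else 0.

(** Registers and array cells that hold no input are initially 0. *)
Definition input_state (G : rotor_game) : state := State
  (fun r => nth 0 [:: #|vertex G|; #|arcs G|] r)
  (fun A => nth (fun=> 0)
    [:: table (@vertex_kind G);
        table (@vertex_value G);
        table (@vertex_rotor G);
        table (fun a : arcs G => enum_rank (arc_head a) : nat);
        table (fun a : arcs G => enum_rank (arc_tail a) : nat);
        table (fun a : arcs G => enum_rank (theta a) : nat)] A).

Definition output_array := 6.

Definition output (G : rotor_game) (s : state) (u : vertex G) : nat :=
  cell s output_array (enum_rank u).

(* Main.v *)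
Require Import Defs.
From mathcomp Require Import all_boot zify.

Set Implicit Arguments.
Unset Strict Implicit.
Unset Printing Implicit Defensive.

(** The walk in a branch of the tree, seen from the neighbour [p] to which the
    branch is attached, is determined by how often the particle comes back to
    [p] before it is absorbed in the branch, and by the value of the absorbing
    sink.  If the branch reached through the slot [j] of a vertex of period [k]
    sends the particle back [r] times, it absorbs at time [r * k + j]: the
    earliest branch absorbs the particle, and every visit of the vertex makes
    all these times decrease by one.  At an option vertex only the branches of minimal [r]
    matter, so it behaves as a vertex of period 2 whose winning branches have
    slot 0 and whose losing ones have slot 1.  As the times are compared
    lexicographically in [(r, j)], keeping the two earliest events of each vertex
    suffices to compute the outcomes of all branches, in both directions of
    every edge: first towards the last vertex left when the leaves of the tree
    are removed one by one, then backwards. *)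

(** * Branches of a tree *)

(** The optimal strategy depends on the start [u], and one option vertex may need different arcs for
    different starts. What does not depend on [u] is the outcome attached to a directed edge,
    because in a walk from [u] every other vertex is judged only from its neighbour towards [u].
    There are two such outcomes per edge of the tree, and each optimal value is read off those of
    the edges leaving [u]. Optimising every branch separately is sound because binary values turn
    outcomes into a chain (losing at once, losing later, never absorbing, winning later, winning at
    once) along which the rule at a vertex is monotone. The machine neither multiplies nor divides,
    so the times r * k + j are never formed: they are compared as pairs, and the quotient that
    counts the returns is [r] plus one comparison of slots. The arc from one vertex to another is
    found in constant time in a square matrix, which stays affordable because memory starts at 0 and
    only the cells of actual arcs are written. *)

Section Tree.
Variables (T : finType) (e : rel T).
Hypothesis e_sym : symmetric e.
Hypothesis e_irr : irreflexive e.
Hypothesis e_acyclic : forall c : seq T, ucycle e c -> size c < 3.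
Implicit Types p v c w : T.

Definition avoid p : rel T := [rel a b | [&& e a b, a != p & b != p]].

(** For an edge of a tree, this is the side of [v] once the edge is cut. *)
Definition branch p v : {set T} := [set w | connect (avoid p) v w].

Lemma avoid_connect_sym p : connect_sym (avoid p).
Proof. by apply: sym_connect_sym => a b; rewrite /avoid /= e_sym [(a != p) && _]andbC. Qed.

Lemma avoid_path p v q : path (avoid p) v q -> path e v q && (p \notin q).
Proof.
elim: q v => //= w q IH v /andP[/and3P[-> vp wp] /IH/andP[-> pq]].
by rewrite inE negb_or eq_sym wp.
Qed.

Lemma branch_refl p v : v \in branch p v.
Proof. by rewrite inE connect0. Qed.

Lemma path_avoid p v q : path e v q -> p \notin v :: q -> path (avoid p) v q.
Proof.
elim: q v => //= w q IH v /andP[vw pq]; rewrite !inE !negb_or => /and3P[pv pw nq].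
by rewrite /avoid /= vw eq_sym pv eq_sym pw IH // inE negb_or pw.
Qed.

(** A simple path from [c] to [c'] that avoids [v] closes up through [v]; unless it is empty, the
    cycle has length at least 3. *)
Lemma neighbor_unique v c c' : e v c -> e v c' -> connect (avoid v) c c' -> c = c'.
Proof.
move=> vc vc' /connectP[q0 pq0 c'E]; move: vc'; rewrite {c'}c'E.
case/shortenP: pq0 => q pq uq _ vc'.
have /andP[eq vq] := avoid_path pq.
have cv : v != c by apply: contraTneq vc => ->; rewrite e_irr.
have cyc : ucycle e (v :: c :: q).
  rewrite /ucycle /cycle -cats1 /= vc cat_path eq /= e_sym vc' /=.
  by rewrite inE negb_or cv vq.
by case: q {pq uq eq vq vc'} cyc => // w q /e_acyclic.
Qed.

Lemma branch_root p v : e p v -> p \notin branch p v.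
Proof.
move=> pv; rewrite inE; apply/negP => /connectP[q pq plast].
have /andP[_ nq] := avoid_path pq.
have := mem_last v q; rewrite -plast inE (negPf nq) orbF => /eqP pv'.
by rewrite pv' e_irr in pv.
Qed.

Lemma branch_disjoint v c c' w :
  e v c -> e v c' -> w \in branch v c -> w \in branch v c' -> c = c'.
Proof.
rewrite !inE => vc vc' cw c'w; apply: (neighbor_unique vc vc').
by apply: connect_trans cw _; rewrite avoid_connect_sym.
Qed.

Lemma branch_step p v c : e p v -> e v c -> c != p -> c \in branch p v.
Proof.
move=> pv vc cp; rewrite inE; apply: connect1; rewrite /avoid /= vc cp andbT.
by apply: contraTneq pv => ->; rewrite e_irr.
Qed.

Lemma branch_sub p v c : e p v -> e v c -> c != p -> branch v c \subset branch p v.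
Proof.
move=> pv vc cp; apply/subsetP => w; rewrite inE => /connectP[q pq ->{w}].
have vp : v != p by apply: contraTneq pv => ->; rewrite e_irr.
elim/last_ind: q pq => [_|q w IH]; first exact: branch_step.
rewrite rcons_path last_rcons => /andP[pq ww].
have cl := IH pq; move: (cl); rewrite !inE => /connect_trans; apply.
apply: connect1; have /and3P[lw lv wv] := ww; rewrite /avoid /= lw /=.
apply/andP; split.
  by apply: contraTneq cl => ->; apply: branch_root.
(* A path stepping onto [p] would join two neighbours of [v] without meeting [v], and [c] would be
   [p]. *)
apply: contra_neq cp => wp; apply: (@neighbor_unique v c p vc); first by rewrite e_sym.
apply: (connect_trans (y := last c q)); first by apply/connectP; exists q.
by apply: connect1; rewrite -wp.
Qed.

Lemma branch_card p v c : e p v -> e v c -> c != p -> #|branch v c| < #|branch p v|.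
Proof.
move=> pv vc cp; apply: proper_card; rewrite properE branch_sub //=.
by apply/subsetPn; exists v; [apply: branch_refl | apply: branch_root].
Qed.

Lemma branch_cover v w : connect e v w -> w != v -> exists2 c, e v c & w \in branch v c.
Proof.
case/connectP => q0 pq0 -> {w}.
case/shortenP: pq0 => [[|c q]] /= => [_ _ _|]; first by rewrite eqxx.
case/andP=> vc pq /andP[vq uq] _ _; exists c => //.
by rewrite inE; apply/connectP; exists q => //; apply: path_avoid.
Qed.

Lemma branch_opposite v w u : e v w -> u \in branch v w -> u \notin branch w v.
Proof.
move=> vw uw; rewrite inE; apply/negP => /connectP[q0 pq0 uE].
case/shortenP: pq0 uE => -[|c q] /= pq uq _ uE.
  by move: uw; rewrite uE; apply/negP; apply: branch_root.
case/andP: pq => /and3P[vc _ cw] pq; have /andP[pe _] := avoid_path pq.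
have uc : u \in branch v c.
  rewrite inE; apply/connectP; exists q => //; apply: path_avoid => //.
  by case/andP: uq.
by rewrite (branch_disjoint vc vw uc uw) eqxx in cw.
Qed.

End Tree.

(** * Branch outcomes *)

Section Outcomes.
Variables (R : rotor_graph) (win : vertex R -> bool) (W : {set vertex R}).
Implicit Types (rho : config R) (p v w : vertex R) (a b : arcs R).

(** Seen from a neighbour [p] of [v], the branch at [v] is summarised by
    [Some (r, x)] if it sends the particle back [r] times and absorbs it on
    its next entry, in a sink of value [x], and by [None] if it never absorbs. *)
Definition outcome := option (nat * bool).

Definition dec (o : outcome) : outcome := if o is Some (r, x) then Some (r.-1, x) else None.

(** The vertices of [W] behave like option vertices with a period of 2: the
    optimal choice is to be absorbed first by a winning branch of minimal [r],
    and failing that to send the particle back as often as possible. *)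
Definition period rho v := if v \in W then 2 else if rho v is Some a then order (@theta R) a else 1.

(** At a rotor vertex [findex] counts the visits before the arc comes up. At an option vertex the
    arc to [p] is looked up with [x] equal to [true], hence has slot 0, and the number of returns is
    the ceiling of T / 2: r for a winning event at time 2r, r + 1 for a losing one at time 2r + 1.
    The extra return comes from starting the rotor on the arc to [p]. *)
Definition slot rho v (x : bool) b : nat :=
  if v \in W then (~~ x : nat) else if rho v is Some a then findex (@theta R) a b else 0.

Definition hit rho v (f : vertex R -> outcome) a :=
  if f (arc_head a) is Some (r, x) then r * period rho v + slot rho v x a else 0.

Definition event p v (f : vertex R -> outcome) a :=
  [&& arc_tail a == v, arc_head a != p & isSome (f (arc_head a))].

Definition first_event rho p v f a :=
  event p v f a && [forall b, event p v f b ==> (hit rho v f a <= hit rho v f b)].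

Definition arc_to v p := [pick b : arcs R | (arc_tail b == v) && (arc_head b == p)].

(** The number of [m] with [m * period + slot < T], where [slot] is that of
    the arc to [p]. *)
Definition returns rho v p T :=
  if arc_to v p is Some b
  then (T + ((period rho v).-1 - slot rho v true b)) %/ period rho v else 0.

(** For [p] equal to [v] no arc is excluded, as there are no loops: this instance describes the walk
    started at [v]. *)
Definition node rho p v (f : vertex R -> outcome) : outcome :=
  if v \in sinks R then Some (0, win v)
  else if [pick a | first_event rho p v f a] is Some a
       then if f (arc_head a) is Some (r, x)
            then Some (returns rho v p (hit rho v f a), x) else None
       else None.

(** The recursion follows directed edges and is not structural, hence the fuel. On the edges of a
    tree the [None] of exhausted fuel does not interfere, since the number of vertices bounds the
    size of every branch. *)
Fixpoint fuel_outcome rho n p v : outcome :=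
  if n is m.+1 then node rho p v (fuel_outcome rho m v) else None.

Definition branch_outcome rho p v := fuel_outcome rho #|vertex R| p v.

Definition rotor_at rho v a := [/\ v \notin sinks R, v \notin W, rho v = Some a & arc_tail a = v].

Hypothesis simple : simple_digraph R.

Lemma arc_to_head a p : arc_head a = p -> arc_to (arc_tail a) p = Some a.
Proof.
rewrite /arc_to => ap; case: pickP => [b /andP[/eqP tb /eqP hb]|/(_ a)].
  by congr Some; apply: simple; rewrite ?hb.
by rewrite ap !eqxx.
Qed.

Lemma arc_toP v p b : arc_to v p = Some b -> arc_tail b = v /\ arc_head b = p.
Proof. by rewrite /arc_to; case: pickP => // c /andP[/eqP ? /eqP ?] [<-]. Qed.

Lemma eq_node rho rho' p v f f' :
  (v \notin W -> rho v = rho' v) ->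
  (forall a, arc_tail a = v -> arc_head a != p -> f (arc_head a) = f' (arc_head a)) ->
  node rho p v f = node rho' p v f'.
Proof.
move=> Er Ef.
have Ep : period rho v = period rho' v by rewrite /period; case: ifPn => // /Er ->.
have Es x b : slot rho v x b = slot rho' v x b by rewrite /slot; case: ifPn => // /Er ->.
have Ee : event p v f =1 event p v f'.
  move=> a; rewrite /event; case: eqP => //= ta; case: eqVneq => //= ha.
  by rewrite Ef.
have Eh a : event p v f a -> hit rho v f a = hit rho' v f' a.
  case/and3P=> /eqP ta ha _; rewrite /hit Ef //.
  by case: (f' _) => [[r x]|] //; rewrite Ep Es.
have Eb : first_event rho p v f =1 first_event rho' p v f'.
  move=> a; rewrite /first_event -Ee; case ea: (event p v f a) => //=.
  apply: eq_forallb => b; rewrite -Ee; case eb: (event p v f b) => //=.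
  by rewrite !Eh.
rewrite /node (eq_pick Eb); case: ifP => // _; case: pickP => // a.
rewrite -Eb => /andP[ea _]; have /and3P[/eqP ta ha _] := ea.
rewrite -(Ef _ ta ha) Eh // /returns.
by case: (f _) => [[r x]|] //; case: arc_to => // b; rewrite Ep Es.
Qed.

Section Rotor.
Variables (rho : config R) (v : vertex R) (a0 : arcs R).
Hypothesis rho_v : rotor_at rho v a0.

Let fconnect_a0 b : arc_tail b = v -> fconnect (@theta R) a0 b.
Proof.
case: rho_v => vs _ _ t0 tb; rewrite fconnect_orbit theta_orbit ?t0 //.
by rewrite inE tb.
Qed.

Lemma slot_rotor x b : slot rho v x b = findex (@theta R) a0 b.
Proof. by case: rho_v => _ vW Er _; rewrite /slot (negPf vW) Er. Qed.

Lemma period_rotor : period rho v = order (@theta R) a0.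
Proof. by case: rho_v => _ vW Er _; rewrite /period (negPf vW) Er. Qed.

Lemma slot_lt x b : arc_tail b = v -> slot rho v x b < period rho v.
Proof. by move=> /fconnect_a0 tb; rewrite slot_rotor period_rotor findex_max. Qed.

Lemma slot_inj x y b c : arc_tail b = v -> arc_tail c = v ->
  slot rho v x b = slot rho v y c -> b = c.
Proof.
by move=> /fconnect_a0 /iter_findex eb /fconnect_a0 /iter_findex ec;
  rewrite !slot_rotor => E; rewrite -eb E.
Qed.

Lemma slot0 x : slot rho v x a0 = 0.
Proof. by rewrite slot_rotor findex0. Qed.

Lemma theta_tail : arc_tail (theta a0) = v.
Proof.
case: rho_v => vs _ _ t0.
have : theta a0 \in orbit (@theta R) a0 by rewrite -fconnect_orbit fconnect1.
by rewrite theta_orbit ?t0 // inE => /eqP ->.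
Qed.

Lemma rotor_at_theta rho' : rho' v = Some (theta a0) -> rotor_at rho' v (theta a0).
Proof. by case: rho_v => vs vW _ _ E; split=> //; apply: theta_tail. Qed.

Lemma order_theta : order (@theta R) (theta a0) = order (@theta R) a0.
Proof.
case: rho_v => vs _ _ t0; rewrite -!size_orbit.
have /card_uniqP <- := orbit_uniq (@theta R) (theta a0).
have /card_uniqP <- := orbit_uniq (@theta R) a0.
by apply: eq_card => b; rewrite !theta_orbit ?theta_tail ?t0.
Qed.

Lemma period_shift rho' : rho' v = Some (theta a0) -> period rho' v = period rho v.
Proof. by case: rho_v => _ vW Er _ E; rewrite /period (negPf vW) Er E order_theta. Qed.

(** A step of the rotor brings every arc closer by one, except the current arc, which goes from slot
    0 to the end of the period. *)
Lemma slot_shift rho' x b : rho' v = Some (theta a0) -> arc_tail b = v ->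
  slot rho' v x b = if b == a0 then (period rho v).-1 else (slot rho v x b).-1.
Proof.
move=> E tb.
case: rho_v => vs vW' _ t0.
rewrite period_rotor slot_rotor /slot (negPf vW') E.
have fb : fconnect (@theta R) (theta a0) b.
  by rewrite fconnect_orbit theta_orbit ?theta_tail // inE tb.
have jk := findex_max fb; have jb := iter_findex fb; rewrite order_theta in jk.
set j := findex _ (theta a0) b in jk jb *.
rewrite -iterSr in jb; move: jk; rewrite leq_eqVlt => /orP[/eqP jk|jk].
  case: eqVneq => [_|bn]; first by rewrite -jk.
  have := findex_max (fconnect_a0 tb); rewrite -jk ltnS => ij.
  have i0 : 0 < findex (@theta R) a0 b.
    by rewrite lt0n findex_eq0 eq_sym.
  have ib := iter_findex (fconnect_a0 tb).
  set i := findex _ a0 b in ij i0 ib *.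
  have : findex (@theta R) (theta a0) b = i.-1.
    by rewrite -ib -(prednK i0) iterSr findex_iter // order_theta -jk; lia.
  by [].
have ej : findex (@theta R) a0 b = j.+1 by rewrite -jb findex_iter.
rewrite ej; case: eqP => // ba; by rewrite ba findex0 in ej.
Qed.

(** Distinct arcs have distinct slots, which are residues modulo the period: at a rotor vertex two
    branches never absorb at the same time. *)
Lemma hit_inj p f b c : event p v f b -> event p v f c ->
  hit rho v f b = hit rho v f c -> b = c.
Proof.
case/and3P=> /eqP tb _ fb /and3P[/eqP tc _ fc]; rewrite /hit.
case: (f _) fb => [[r x]|] // _; case: (f _) fc => [[r' x']|] // _.
move=> /(congr1 (modn^~ (period rho v))); rewrite !modnMDl !modn_small ?slot_lt //.
exact: slot_inj.
Qed.

End Rotor.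

Definition ruled rho v := v \in W \/ exists a, rotor_at rho v a.

Lemma first_event_exists rho p v f a : event p v f a ->
  exists b, first_event rho p v f b.
Proof.
move=> ea; case: (arg_minnP (hit rho v f) ea) => b eb bmin; exists b.
by rewrite /first_event eb /=; apply/forallP => c; apply/implyP; apply: bmin.
Qed.

Lemma first_event_le rho p v f a b :
  first_event rho p v f a -> event p v f b -> hit rho v f a <= hit rho v f b.
Proof. by case/andP => _ /forallP/(_ b)/implyP; apply. Qed.

(** Ties occur only at option vertices, where the common time r * 2 + ~~ x determines both [r] and
    [x]; so it does not matter which earliest arc [pick] returns. *)
Lemma node_first rho p v f a r x : v \notin sinks R -> ruled rho v ->
  first_event rho p v f a -> f (arc_head a) = Some (r, x) ->
  node rho p v f = Some (returns rho v p (hit rho v f a), x).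
Proof.
move=> vs ru fa fE; rewrite /node (negPf vs); case: pickP => [b fb|/(_ a)]; last by rewrite fa.
have [/andP[ea _] /andP[eb _]] := (fa, fb).
have hab : hit rho v f a = hit rho v f b.
  by apply/eqP; rewrite eqn_leq (first_event_le fa) ?(first_event_le fb).
case: ru => [vW|[a0 rot]]; last by rewrite -(hit_inj rot ea eb hab) fE.
have /and3P[_ _] := eb; move: hab; case Eb: (f (arc_head b)) => [[r' x']|] // hab _.
rewrite -hab; congr Some; congr pair; move: hab; rewrite /hit fE Eb /slot vW /period vW.
by case: x x' {Eb fE} => [] [] //=; lia.
Qed.

Lemma node_none rho p v f : v \notin sinks R ->
  node rho p v f = None -> forall a, ~~ event p v f a.
Proof.
move=> vs; rewrite /node (negPf vs); case: pickP => [a /andP[/and3P[_ _]]|nf _ a].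
  by case: (f _) => [[]|].
by apply/negP => /first_event_exists-/(_ rho)[b]; rewrite nf.
Qed.

Lemma node_some rho p v f R' x : v \notin sinks R -> node rho p v f = Some (R', x) ->
  exists a r, [/\ first_event rho p v f a, f (arc_head a) = Some (r, x)
    & R' = returns rho v p (hit rho v f a)].
Proof.
move=> vs; rewrite /node (negPf vs); case: pickP => // a fa.
by case fE: (f _) => [[r y]|] // [<- <-]; exists a, r.
Qed.

Lemma leq_returns rho p v T T' : T <= T' -> returns rho v p T <= returns rho v p T'.
Proof. by move=> TT'; rewrite /returns; case: arc_to => // b; rewrite leq_div2r // leq_add2r. Qed.

Lemma node_no_event rho p v f : v \notin sinks R ->
  (forall a, ~~ event p v f a) -> node rho p v f = None.
Proof.
move=> vs ne; rewrite /node (negPf vs); case: pickP => // a.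
by rewrite /first_event (negPf (ne a)).
Qed.

(** For an arc other than [a0] the slot drops by one; for [a0], r * k becomes (r - 1) * k + (k - 1).
    Here [r] is positive because the branch just visited is assumed not to absorb. *)
Lemma node_shift rho rho' p v a0 f f' : rotor_at rho v a0 -> rho' v = Some (theta a0) ->
  (forall b, arc_tail b = v -> arc_head b != p ->
    f' (arc_head b) = if arc_head b == arc_head a0 then dec (f (arc_head b)) else f (arc_head b)) ->
  (arc_head a0 != p -> forall x, f (arc_head a0) <> Some (0, x)) ->
  (forall b, event p v f' b = event p v f b) /\
  (forall b, event p v f b -> hit rho v f b = (hit rho' v f' b).+1).
Proof.
move=> rot E' Ef nz; split=> [b|b /and3P[/eqP tb hb]].
  rewrite /event; case: eqP => //= tb; case: eqVneq => //= hb; rewrite Ef //.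
  by case: eqP => // _; case: (f _) => [[]|].
rewrite /hit Ef // (period_shift rot E').
have [_ _ _ t0] := rot.
case: (eqVneq b a0) hb => [-> hb|ba hb].
  rewrite eqxx /=; have := nz hb.
  case: (f _) => [[[|r] x]|] //= nz0 _; first by case: (nz0 x).
  rewrite (slot_shift rot _ E') // eqxx (slot0 rot) /= mulSn.
  have := slot_lt rot x t0; lia.
have -> : arc_head b == arc_head a0 = false.
  by apply: contraNF ba => /eqP hh; apply/eqP/simple; rewrite ?tb.
case: (f _) => [[r x]|] // _; rewrite (slot_shift rot _ E') // (negPf ba).
suff : 0 < slot rho v x b by lia.
rewrite lt0n; apply: contraNneq ba => s0; apply/eqP.
by apply: (slot_inj rot (x := x) (y := x)) => //; rewrite (slot0 rot).
Qed.

(** The loss of one in [T] is balanced by the loss of one in the slot of the arc to [p], unless the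
    rotor was on that arc: then a whole period is lost, which is the return just made. *)
Lemma returns_shift rho rho' p v a0 T : rotor_at rho v a0 -> rho' v = Some (theta a0) ->
  returns rho' v p T = if arc_head a0 == p then (returns rho v p T.+1).-1
                       else returns rho v p T.+1.
Proof.
move=> rot E'; rewrite /returns (period_shift rot E').
have [_ _ _ t0] := rot.
case Eb: (arc_to v p) => [b|]; last by rewrite if_same.
have [tb hb] := arc_toP Eb; rewrite (slot_shift rot _ E') //.
have k0 := slot_lt rot true tb.
case: (eqVneq b a0) => [ba|ba].
  have k1 : 0 < period rho v by apply: leq_ltn_trans k0.
  rewrite -{1}ba hb eqxx ba (slot0 rot) subnn subn0 addn0.
  by rewrite addSnnS prednK // divnDr // divnn k1 addn1.
have -> : arc_head a0 == p = false.
  by apply: contraNF ba => /eqP hh; apply/eqP/simple; rewrite ?tb ?hb.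
congr (_ %/ _); suff : 0 < slot rho v true b by lia.
rewrite lt0n; apply: contraNneq ba => s0; apply/eqP.
by apply: (slot_inj rot (x := true) (y := true)) => //; rewrite (slot0 rot).
Qed.

Lemma node_shiftE rho rho' p v a0 f f' : rotor_at rho v a0 -> rho' v = Some (theta a0) ->
  (forall b, arc_tail b = v -> arc_head b != p ->
    f' (arc_head b) = if arc_head b == arc_head a0 then dec (f (arc_head b)) else f (arc_head b)) ->
  (arc_head a0 != p -> forall x, f (arc_head a0) <> Some (0, x)) ->
  node rho' p v f' = if arc_head a0 == p then dec (node rho p v f) else node rho p v f.
Proof.
move=> rot E' Ef nz; have [Ee Eh] := node_shift rot E' Ef nz.
have [vs _ _ _] := rot.
have rot' := rotor_at_theta rot E'.
case: (pickP (first_event rho p v f)) => [a fa|nf]; last first.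
  have ne b : ~~ event p v f b.
    by apply/negP => /first_event_exists-/(_ rho)[c]; rewrite nf.
  by rewrite !node_no_event ?if_same // => b; rewrite Ee.
have /andP[ea _] := fa.
have fa' : first_event rho' p v f' a.
  rewrite /first_event Ee ea; apply/forallP => b; apply/implyP; rewrite Ee => eb.
  by have := first_event_le fa eb; rewrite !Eh.
have ruled0 : ruled rho v by right; exists a0.
have ruled1 : ruled rho' v by right; exists (theta a0).
have /and3P[/eqP ta ha fE] := ea; case fE: (f (arc_head a)) fE => [[r x]|] // _.
have [r' fE'] : exists r', f' (arc_head a) = Some (r', x).
  by rewrite Ef // fE; case: eqP => _ /=; eexists.
rewrite (node_first vs ruled0 fa fE) (node_first vs ruled1 fa' fE') Eh //.
by rewrite (returns_shift _ _ rot E'); case: ifP.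
Qed.

End Outcomes.

(** * Rotor walks *)

Section Adjacency.
Variable G : digraph.

Lemma adj_sym : symmetric (@adj G).
Proof. by move=> u v; rewrite /adj orbC. Qed.

Lemma adj_irr : irreflexive (@adj G).
Proof.
move=> u; rewrite /adj orbb; apply/negbTE/existsP => -[a /andP[/eqP ta /eqP ha]].
by have := arc_loopless a; rewrite ta ha eqxx.
Qed.

Lemma arc_rel_arc (a : arcs G) : arc_rel (arc_tail a) (arc_head a).
Proof. by apply/existsP; exists a; rewrite !eqxx. Qed.

Lemma arc_rel_adj u v : @arc_rel G u v -> adj u v.
Proof. by rewrite /adj => ->. Qed.

Lemma adj_head (a : arcs G) v : arc_tail a = v -> adj v (arc_head a).
Proof. by move=> <-; apply/arc_rel_adj/arc_rel_arc. Qed.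

End Adjacency.

Section TreeRotor.
Variable R : rotor_graph.
Hypothesis treeR : tree_like R.
Hypothesis stopR : stopping R.
Hypothesis simple : simple_digraph R.
Variable win : vertex R -> bool.
Implicit Types (rho : config R) (p v w : vertex R) (a b : arcs R) (W : {set vertex R}).

Let acyclic : forall c : seq (vertex R), ucycle (@adj R) c -> size c < 3.
Proof. by case: treeR => -[]. Qed.

Local Notation branch := (branch (@adj R)).

Lemma adj_branch_root p v : adj p v -> p \notin branch p v.
Proof. exact: (branch_root (@adj_irr R)). Qed.

Lemma adj_branch_sub p v c : adj p v -> adj v c -> c != p -> branch v c \subset branch p v.
Proof. exact: (branch_sub (@adj_sym R) (@adj_irr R) acyclic). Qed.

Lemma adj_branch_card p v c : adj p v -> adj v c -> c != p -> #|branch v c| < #|branch p v|.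
Proof. exact: (branch_card (@adj_sym R) (@adj_irr R) acyclic). Qed.

Lemma adj_branch_disjoint v c c' w :
  adj v c -> adj v c' -> w \in branch v c -> w \in branch v c' -> c = c'.
Proof. exact: (branch_disjoint (@adj_sym R) (@adj_irr R) acyclic). Qed.

(** Going from [(p, v)] to [(v, c)] makes the branch strictly smaller, since it loses [v]. *)
Lemma branch_ind (P : vertex R -> vertex R -> Prop) :
  (forall p v, adj p v -> (forall c, adj v c -> c != p -> P v c) -> P p v) ->
  forall p v, adj p v -> P p v.
Proof.
move=> H p v; have [n] := ubnP #|branch p v|; elim: n p v => // n IH p v le pv.
apply: H => // c vc cp; apply: IH => //.
by apply: leq_trans (adj_branch_card pv vc cp) _.
Qed.

Lemma fuel_outcome_enough W rho n m p v : adj p v -> #|branch p v| <= n -> #|branch p v| <= m ->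
  fuel_outcome win W rho n p v = fuel_outcome win W rho m p v.
Proof.
have gt0 q u : 0 < #|branch q u| by apply/card_gt0P; exists u; apply: branch_refl.
elim: n m p v => [|n IH] [|m] p v pv; rewrite ?leqn0 ?(gtn_eqF (gt0 p v)) //.
move=> ln lm /=; apply: eq_node => // a ta ha.
have va := adj_head ta; have lt := adj_branch_card pv va ha.
by apply: IH => //; rewrite -ltnS; apply: leq_trans lt _.
Qed.

Lemma branch_outcomeE W rho p v : adj p v ->
  branch_outcome win W rho p v = node win W rho p v (branch_outcome win W rho v).
Proof.
move=> pv; rewrite {1}/branch_outcome.
rewrite (fuel_outcome_enough W rho (m := #|vertex R|.+1) pv) ?max_card //.
by apply: leqW; apply: max_card.
Qed.

Lemma eq_branch_outcome W rho rho' p v : adj p v ->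
  {in branch p v, forall w, w \notin W -> rho w = rho' w} ->
  branch_outcome win W rho p v = branch_outcome win W rho' p v.
Proof.
move=> pv; elim/branch_ind: pv => {}p {}v pv IH E; rewrite !branch_outcomeE //.
apply: eq_node => [|a ta ha]; first by apply: E; apply: branch_refl.
have va := adj_head ta; apply: IH => // w wa; apply: E.
by apply: subsetP wa; apply: adj_branch_sub.
Qed.

Lemma branch_outcome_reach W rho p v q : adj p v -> path (@arc_rel R) v q ->
  uniq (v :: q) -> p \notin q -> last v q \in sinks R ->
  branch_outcome win W rho p v <> None.
Proof.
elim: q p v => [|w q IH] p v pv; rewrite branch_outcomeE //.
  by move=> _ _ _ vs; rewrite /node vs.
move=> /andP[vw pq] /= /andP[vq uq]; rewrite inE negb_or eq_sym => /andP[wp npq] ls.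
case: (boolP (v \in sinks R)) => vs; first by rewrite /node vs.
have /existsP[a /andP[/eqP ta /eqP ha]] := vw.
move=> /(node_none vs)/(_ a)/negP; apply; rewrite /event ta ha eqxx wp /=.
rewrite inE negb_or in vq; case/andP: vq => _ vq.
by case E: (branch_outcome _ _ _ _ _) (IH _ _ (arc_rel_adj vw) pq uq vq ls) => [x|].
Qed.

Lemma uniq_path_to_sink v : exists q,
  [/\ path (@arc_rel R) v q, uniq (v :: q) & last v q \in sinks R].
Proof.
have [s ss /connectP[q0 pq0 sE]] := stopR v.
by case/shortenP: pq0 sE => q pq uq _ sE; exists q; rewrite -sE.
Qed.

(** Some simple directed path leads from [v] to a sink. It must leave a branch that never absorbs,
    hence pass through [p], and in a tree it can only do so straight from [v]. *)
Lemma branch_outcome_None W rho p v : adj p v -> branch_outcome win W rho p v = None ->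
  exists2 b, arc_tail b = v & arc_head b = p.
Proof.
move=> pv oN; have [q [pq uq ls]] := uniq_path_to_sink v.
case: (boolP (p \in q)) => [|npq]; last first.
  by case: (branch_outcome_reach pv pq uq npq ls oN).
move=> pq'; case/splitPr: pq' pq uq {ls} => q1 q2.
rewrite cat_path => /andP[pq1 /= /andP[lp _]] /andP[vq].
rewrite mem_cat inE !negb_or in vq; have /and3P[vq1 vp _] := vq.
rewrite cat_uniq => /and3P[uq1 nq _].
case: q1 pq1 lp vq1 nq uq1 {vq} => [_ /existsP[b /andP[/eqP tb /eqP hb]]|w q1] /=.
  by exists b.
case/andP=> vw pq1 lp vq1 /norP[npq1 _] uq1.
suff wp : w = p by rewrite wp inE eqxx in npq1.
apply: (neighbor_unique (@adj_sym R) (@adj_irr R) acyclic (v := v)).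
- exact: arc_rel_adj.
- by rewrite adj_sym.
apply/connectP; exists (rcons q1 p); last by rewrite last_rcons.
apply: path_avoid; last first.
  by rewrite inE mem_rcons inE !negb_or vp andbCA -negb_or -in_cons vq1.
by apply: sub_path (_ : path (@arc_rel R) w (rcons q1 p)); [exact: arc_rel_adj | rewrite rcons_path pq1].
Qed.

Lemma root_event W rho v : v \notin sinks R ->
  exists b, event v v (branch_outcome win W rho v) b.
Proof.
move=> vs; have [[|w q] [/= pq uq ls]] := uniq_path_to_sink v; first by rewrite ls in vs.
case/andP: pq => vw pq; have /existsP[a /andP[/eqP ta /eqP ha]] := vw.
rewrite inE negb_or in uq; have /andP[/andP[nvw vq] uq'] := uq.
exists a; rewrite /event ta ha eqxx eq_sym nvw /=.
by case: (branch_outcome _ _ _ _ _) (branch_outcome_reach (W := W) (rho := rho) (arc_rel_adj vw) pq uq' vq ls).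
Qed.

Definition total_config rho := forall u, u \notin sinks R -> exists a, rotor_at set0 rho u a.

Definition absorbs rho v x := exists2 s, maximal_walk rho v s & win s = x.

(** The walk from [v] realises the outcome [F rho]: it is absorbed at once, or
    it reaches [p] having changed [rho] on [X] only. *)
Definition walks rho p v (X : {set vertex R}) (F : config R -> outcome) :=
  if F rho is Some (0, x) then absorbs rho v x else
  exists rho', [/\ total_config rho', forall w, w \notin X -> rho' w = rho w, F rho' = dec (F rho)
    & forall s, maximal_walk rho' p s -> maximal_walk rho v s].

Lemma total_theta rho v a : total_config rho -> rotor_at set0 rho v a ->
  total_config (set_rotor rho v (theta a)).
Proof.
move=> tot rot u us; case: (eqVneq u v) => [->|uv].
  by exists (theta a); apply: (rotor_at_theta rot); rewrite ffunE eqxx.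
by have [b [? ? ? ?]] := tot u us; exists b; split; rewrite // ffunE (negPf uv).
Qed.

(** Induction on a bound [k] on the number of visits of [v]: each visit lowers by one the slot of
    the arc to [p] and the times of all events, so one of them comes up. The vertex [p] is
    arbitrary, so that [p] equal to [v] covers the start of a walk. *)
Lemma walks_vertex p v (X : {set vertex R}) :
  v \in X -> (forall c, adj v c -> c != p -> branch v c \subset X) ->
  (forall rho c, adj v c -> c != p -> total_config rho ->
     walks rho v c (branch v c) (fun r => branch_outcome win set0 r v c)) ->
  forall k rho, v \notin sinks R -> total_config rho ->
  let f := branch_outcome win set0 rho v in
  (exists2 b, arc_tail b = v /\ arc_head b = p & slot set0 rho v true b < k) \/
  (exists2 b, event p v f b & hit set0 rho v f b < k) ->
  walks rho p v X (fun r => node win set0 r p v (branch_outcome win set0 r v)).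
Proof.
move=> vX subX IH; elim=> [|k IHk] rho vs tot f early; first by case: early => -[].
have [a0 rot] := tot v vs; have [_ _ Er t0] := rot.
set rho1 := set_rotor rho v (theta a0).
have E1 : rho1 v = Some (theta a0) by rewrite ffunE eqxx.
have E1n w : w != v -> rho1 w = rho w by rewrite ffunE => /negPf ->.
have tot1 : total_config rho1 by apply: total_theta.
have out1 c : adj v c -> branch_outcome win set0 rho1 v c = f c.
  move=> vc; apply: eq_branch_outcome => // w wc _; apply: E1n.
  by apply: contraTneq wc => ->; apply: adj_branch_root.
have ruled0 : ruled set0 rho v by right; exists a0.
have walk1 s : maximal_walk rho1 (arc_head a0) s -> maximal_walk rho v s.
  exact: walk_step.
(* When the rotor points to [p] the particle leaves at once, and it remains to see that the outcome
   loses exactly one return. *)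
case: (eqVneq (arc_head a0) p) => hp.
  have Ef b : arc_tail b = v -> arc_head b != p ->
      branch_outcome win set0 rho1 v (arc_head b) =
      if arc_head b == arc_head a0 then dec (f (arc_head b)) else f (arc_head b).
    by move=> tb hb; rewrite out1 ?adj_head // hp (negPf hb).
  have nz : arc_head a0 != p -> forall x, f (arc_head a0) <> Some (0, x) by rewrite hp eqxx.
  have := node_shiftE win simple rot E1 Ef nz; rewrite hp eqxx => nE.
  have [_ Eh] := node_shift simple rot E1 Ef nz.
  rewrite /walks -/f; case nE0: (node _ _ _ _ _ f) => [[[|r] x]|].
  (* An outcome without returns is impossible here: every event has a positive time, whereas the arc
     to [p] has slot 0. *)
  - have : exists b, first_event set0 rho p v f b.
      case: (pickP (first_event set0 rho p v f)) => [b|nf]; first by exists b.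
      move: nE0; rewrite node_no_event // => b.
      by apply/negP => /(first_event_exists set0 rho)[c]; rewrite nf.
    case=> b fb; have /andP[eb _] := fb; have /and3P[_ _] := eb.
    case fE: (f _) => [[r y]|] // _.
    move: nE0; rewrite (node_first _ vs ruled0 fb fE) (Eh _ eb) /returns -hp -t0 arc_to_head // t0.
    have k0 := slot_lt rot true t0; rewrite (slot0 rot) subn0 addSnnS prednK; last by apply: leq_ltn_trans k0.
    by rewrite divnDr // divnn (leq_ltn_trans _ k0) // addn1.
  - exists rho1; split=> //; first by move=> w wX; apply: E1n; apply: contraNneq wX => ->.
    + by rewrite nE nE0.
    + by move=> s; rewrite -hp; apply: walk1.
  - exists rho1; split=> //; first by move=> w wX; apply: E1n; apply: contraNneq wX => ->.
    + by rewrite nE nE0.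
    + by move=> s; rewrite -hp; apply: walk1.
have va : adj v (arc_head a0) by apply: adj_head.
have := IH rho1 _ va hp tot1; rewrite {1}/walks out1 //.
have ev x r : f (arc_head a0) = Some (r, x) -> event p v f a0.
  by rewrite /event t0 eqxx hp => ->.
(* Either the branch entered absorbs now, as the event of time 0, or it gives the particle back to
   [v] and the induction on [k] applies. *)
case: (boolP [exists x, f (arc_head a0) == Some (0, x)]) => [/existsP[x /eqP f0]|nz'].
  rewrite f0 /walks => -[s ws sx].
  have e0 := ev _ _ f0.
  have h0 : hit set0 rho v f a0 = 0 by rewrite /hit f0 (slot0 rot).
  have fst0 : first_event set0 rho p v f a0.
    by rewrite /first_event e0 h0; apply/forallP => b; rewrite implybT.
  rewrite -/f (node_first _ vs ruled0 fst0 f0) h0 /returns.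
  have -> : (if arc_to v p is Some b then (0 + ((period set0 rho v).-1 - slot set0 rho v true b)) %/ period set0 rho v else 0) = 0.
    case: arc_to => // b; rewrite divn_small //.
    by have := slot_lt rot true t0; lia.
  by exists s => //; apply: walk1.
have nz x : f (arc_head a0) <> Some (0, x).
  by move=> E; move/existsPn/(_ x): nz'; rewrite E eqxx.
have H (o : outcome) (A B : Prop) : (forall x, o <> Some (0, x)) ->
    (if o is Some (0, x) then A else B) -> B by case: o => [[[|r] x]|] // /(_ x).
move=> Hw; have {Hw} : exists rho2, [/\ total_config rho2,
    forall w, w \notin branch v (arc_head a0) -> rho2 w = rho1 w,
    branch_outcome win set0 rho2 v (arc_head a0) = dec (f (arc_head a0))
    & forall s, maximal_walk rho2 v s -> maximal_walk rho1 (arc_head a0) s].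
  by move: Hw nz; case: (f _) => [[[|r] x]|] // _ /(_ x).
case=> rho2 [tot2 E2 out2 walk2].
have Ef b : arc_tail b = v -> arc_head b != p ->
    branch_outcome win set0 rho2 v (arc_head b) =
    if arc_head b == arc_head a0 then dec (f (arc_head b)) else f (arc_head b).
  move=> tb hb; case: eqVneq => [->|hne]; first exact: out2.
  have vb := adj_head tb; rewrite -out1 //; apply: eq_branch_outcome => // w wb _.
  by apply: E2; apply: contraNN hne => wa; rewrite (adj_branch_disjoint vb va wb wa).
have E2v : rho2 v = Some (theta a0) by rewrite E2 ?adj_branch_root.
have nz2 : arc_head a0 != p -> forall x, f (arc_head a0) <> Some (0, x) by [].
have := node_shiftE win simple rot E2v Ef nz2; rewrite (negPf hp) => nE.
have [Ee Eh] := node_shift simple rot E2v Ef nz2.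
have := IHk rho2 vs tot2.
have early2 : (exists2 b, arc_tail b = v /\ arc_head b = p & slot set0 rho2 v true b < k) \/
    (exists2 b, event p v (branch_outcome win set0 rho2 v) b &
       hit set0 rho2 v (branch_outcome win set0 rho2 v) b < k).
  case: early => [[b [tb hb] lt]|[b eb lt]]; [left|right]; exists b => //.
  - have ba : b != a0 by apply: contraNneq hp => <-; apply/eqP.
    rewrite (slot_shift rot _ E2v tb) (negPf ba) -ltnS prednK // lt0n.
    apply: contraNneq ba => s0; apply/eqP.
    by apply: (slot_inj rot (x := true) (y := true)) => //; rewrite (slot0 rot).
  - by rewrite Ee.
  - by rewrite Eh in lt.
move=> /(_ early2); rewrite /walks nE -/f.
have back2 s : maximal_walk rho2 v s -> maximal_walk rho v s.
  by move=> /walk2; apply: walk1.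
have E2X w : w \notin X -> rho2 w = rho w.
  move=> wX; have wv : w != v by apply: contraNneq wX => ->.
  rewrite E2 ?E1n //; apply: contraNN wX; exact: subsetP (subX _ va hp) w.
case: (node _ _ _ _ _ f) => [[[|r] x]|].
- by case=> s ws sx; exists s => //; apply: back2.
- case=> rho3 [tot3 E3 out3 walk3]; exists rho3; split=> // [w wX|s /walk3]; last exact: back2.
  by rewrite E3 ?E2X.
- case=> rho3 [tot3 E3 out3 walk3]; exists rho3; split=> // [w wX|s /walk3]; last exact: back2.
  by rewrite E3 ?E2X.
Qed.

Lemma walks_branch p v : adj p v -> forall rho, total_config rho ->
  walks rho p v (branch p v) (fun r => branch_outcome win set0 r p v).
Proof.
move=> pv; elim/branch_ind: pv => {}p {}v pv IH rho tot.
have E r : branch_outcome win set0 r p v = node win set0 r p v (branch_outcome win set0 r v).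
  exact: branch_outcomeE.
case: (boolP (v \in sinks R)) => vs.
  by rewrite /walks E /node vs; exists v => //; apply: walk_stop.
suff : walks rho p v (branch p v) (fun r => node win set0 r p v (branch_outcome win set0 r v)).
  by rewrite /walks -E; case: branch_outcome => [[[|r] x]|] //= [r' [? ? ? ?]];
    exists r'; split; rewrite ?E.
have early k : (exists2 b, arc_tail b = v /\ arc_head b = p & slot set0 rho v true b < k) \/
    (exists2 b, event p v (branch_outcome win set0 rho v) b &
     hit set0 rho v (branch_outcome win set0 rho v) b < k) ->
    walks rho p v (branch p v) (fun r => node win set0 r p v (branch_outcome win set0 r v)).
  apply: walks_vertex => // [|c vc cp|rho' c vc cp].
  - exact: branch_refl.
  - exact: adj_branch_sub.
  - exact: IH.
case oE: (branch_outcome win set0 rho p v) => [o|].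
  case: (pickP (event p v (branch_outcome win set0 rho v))) => [b eb|ne].
    by apply: (early (hit set0 rho v (branch_outcome win set0 rho v) b).+1); right; exists b.
  by move: oE; rewrite E node_no_event // => b; rewrite ne.
(* In the absence of events, the arc back to [p] bounds the number of visits. *)
have [b tb hb] := branch_outcome_None pv oE.
by apply: (early (slot set0 rho v true b).+1); left; exists b.
Qed.

(** The visit induction is used with [p] equal to [v]: as no arc is a loop, there are 0 returns and
    the walk is absorbed. *)
Lemma root_walk rho v : total_config rho ->
  exists r x, node win set0 rho v v (branch_outcome win set0 rho v) = Some (r, x) /\
    absorbs rho v x.
Proof.
move=> tot; case: (boolP (v \in sinks R)) => vs.
  by exists 0, (win v); rewrite /node vs; split=> //; exists v => //; apply: walk_stop.
have [b eb] := root_event set0 rho vs.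
have := @walks_vertex v v setT (in_setT v) (fun c _ _ => subsetT _)
  (fun rho c vc _ => @walks_branch v c vc rho) _ rho vs tot
  (or_intror (ex_intro2 _ _ b eb (ltnSn _))).
rewrite /walks /node (negPf vs); case: pickP => [a fa|nf].
  have /andP[/and3P[_ _ fE] _] := fa; case: (branch_outcome _ _ _ _ (arc_head a)) fE => [[r x]|] // _.
  rewrite /returns /arc_to; case: pickP => [c /andP[/eqP tc /eqP hc]|_].
    by have := arc_loopless c; rewrite tc hc eqxx.
  by move=> ab; exists 0, x.
by have [c] := first_event_exists set0 rho eb; rewrite nf.
Qed.

Lemma maximal_walk_unique rho v s s' : maximal_walk rho v s -> maximal_walk rho v s' -> s = s'.
Proof.
elim=> {rho v s} [rho s ss|rho u a s us ru _ IH] w.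
  by case: w ss => // rho0 u a s0 us _ _ ss; rewrite ss in us.
apply: IH; case: w us ru => [rho0 s0 ss|rho0 u0 b s0 us0 rb w] us ru; first by rewrite ss in us.
by move: rb; rewrite ru => -[->].
Qed.

End TreeRotor.

(** * Optimal play *)

(** [o2] is at least as good as [o1] for the player, who wants the value
    [true]: a winning branch should absorb early, a losing one late. *)
Definition ole (o1 o2 : outcome) : Prop :=
  (forall r, o1 = Some (r, true) -> exists2 r', o2 = Some (r', true) & r' <= r) /\
  (forall r', o2 = Some (r', false) -> exists2 r, o1 = Some (r, false) & r <= r').

Lemma ole_refl o : ole o o.
Proof. by split=> r E; exists r. Qed.

Lemma ole_anti o1 o2 : ole o1 o2 -> ole o2 o1 -> o1 = o2.
Proof.
case=> H1 H2 [K1 K2]; case: o1 o2 H1 H2 K1 K2 => [[r []]|] [[r' []]|] H1 H2 K1 K2 //.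
- have [s [<-] sr] := H1 r erefl; have [t [<-] rt] := K1 r' erefl.
  by congr (Some (_, _)); apply/eqP; rewrite eqn_leq sr rt.
- by have [] := H1 r erefl.
- by have [] := H1 r erefl.
- by have [] := K1 r' erefl.
- have [s [<-] sr] := H2 r' erefl; have [t [<-] rt] := K2 r erefl.
  by congr (Some (_, _)); apply/eqP; rewrite eqn_leq sr rt.
- by have [] := K2 r erefl.
- by have [] := K1 r' erefl.
- by have [] := H2 r' erefl.
Qed.

(** * Monotonicity of the rule at a vertex *)

Section NodeOrder.
Variables (R : rotor_graph) (win : vertex R -> bool).
Variables (W1 W2 : {set vertex R}) (rho1 rho2 : config R) (p v : vertex R).
Variables (f1 f2 : vertex R -> outcome).
Hypothesis le_f : forall a, arc_tail a = v -> arc_head a != p ->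
  ole (f1 (arc_head a)) (f2 (arc_head a)).
Variable a0 : arcs R.
Hypothesis rot1 : rotor_at W1 rho1 v a0.

Let vs : v \notin sinks R. Proof. by case: rot1. Qed.

Let ruled1 : ruled W1 rho1 v. Proof. by right; exists a0. Qed.

Let period_gt0 : 0 < period W1 rho1 v.
Proof. by case: (rot1) => _ _ _ t0; apply: leq_ltn_trans (slot_lt rot1 true t0). Qed.

Lemma event_some f a : event p v f a ->
  [/\ arc_tail a = v, arc_head a != p & exists r x, f (arc_head a) = Some (r, x)].
Proof.
by case/and3P=> /eqP ta ha; case fE: (f _) => [[r x]|] // _; split=> //; exists r, x.
Qed.

Lemma event_of f a r x : arc_tail a = v -> arc_head a != p ->
  f (arc_head a) = Some (r, x) -> event p v f a.
Proof. by move=> ta ha fE; rewrite /event ta eqxx ha fE. Qed.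

(** Better branches win earlier or lose later. A losing event that came first on the better side
    would come at least as early on the worse side, no later than the winning event that is first
    there; by injectivity of the times both would be the same arc. *)
Lemma node_rotor_ole : rotor_at W2 rho2 v a0 ->
  ole (node win W1 rho1 p v f1) (node win W2 rho2 p v f2).
Proof.
move=> rot2; have ruled2 : ruled W2 rho2 v by right; exists a0.
have kE : period W2 rho2 v = period W1 rho1 v by rewrite (period_rotor rot1) (period_rotor rot2).
have sE x b : slot W2 rho2 v x b = slot W1 rho1 v true b.
  by rewrite (slot_rotor rot1) (slot_rotor rot2).
have sE1 x b : slot W1 rho1 v x b = slot W1 rho1 v true b by rewrite !(slot_rotor rot1).
have rE T : returns W2 rho2 v p T = returns W1 rho1 v p T.
  by rewrite /returns kE; case: arc_to => // b; rewrite sE.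
have h1 b r x : f1 (arc_head b) = Some (r, x) ->
    hit W1 rho1 v f1 b = r * period W1 rho1 v + slot W1 rho1 v true b.
  by rewrite /hit => ->; rewrite sE1.
have h2 b r x : f2 (arc_head b) = Some (r, x) ->
    hit W2 rho2 v f2 b = r * period W1 rho1 v + slot W1 rho1 v true b.
  by rewrite /hit => ->; rewrite sE kE.
have mono r r' b : r <= r' -> r * period W1 rho1 v + slot W1 rho1 v true b <=
    r' * period W1 rho1 v + slot W1 rho1 v true b.
  by move=> rr; rewrite leq_add2r leq_mul2r rr orbT.
split=> [r0|r0] /(node_some vs)[a [r [fa fE ->]]]; have /andP[ea _] := fa;
  have [ta ha _] := event_some ea; have [le1 le2] := le_f ta ha.
- have [r' fE' rr] := le1 _ fE.
  have ea' : event p v f2 a := event_of ta ha fE'.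
  have [b fb] := first_event_exists W2 rho2 ea'; have /andP[eb _] := fb.
  have [tb hb [r2 [x fEb]]] := event_some eb.
  have le21 : hit W2 rho2 v f2 b <= hit W1 rho1 v f1 a.
    by apply: leq_trans (first_event_le fb ea') _; rewrite (h2 _ _ _ fE') (h1 _ _ _ fE) mono.
  rewrite (node_first _ vs ruled2 fb fEb) rE.
  case: x fEb => fEb; first by eexists; [reflexivity | apply: leq_returns].
  have [_ /(_ _ fEb)[r1 fEb1 r12]] := le_f tb hb.
  have eb1 : event p v f1 b := event_of tb hb fEb1.
  have le12 : hit W1 rho1 v f1 b <= hit W2 rho2 v f2 b.
    by rewrite (h1 _ _ _ fEb1) (h2 _ _ _ fEb) mono.
  have ab : a = b.
    apply: (hit_inj rot1 ea eb1); apply/eqP; rewrite eqn_leq (first_event_le fa) //=.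
    exact: leq_trans le12 le21.
  by move: fE; rewrite ab fEb1.
- have [r' fE' rr] := le2 _ fE.
  have ea' : event p v f1 a := event_of ta ha fE'.
  have [b fb] := first_event_exists W1 rho1 ea'; have /andP[eb _] := fb.
  have [tb hb [r2 [x fEb]]] := event_some eb.
  have le21 : hit W1 rho1 v f1 b <= hit W2 rho2 v f2 a.
    by apply: leq_trans (first_event_le fb ea') _; rewrite (h2 _ _ _ fE) (h1 _ _ _ fE') mono.
  rewrite (node_first _ vs ruled1 fb fEb) rE.
  case: x fEb => fEb; last by eexists; [reflexivity | apply: leq_returns].
  have [/(_ _ fEb)[r1 fEb1 r12] _] := le_f tb hb.
  have eb1 : event p v f2 b := event_of tb hb fEb1.
  have le12 : hit W2 rho2 v f2 b <= hit W1 rho1 v f1 b.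
    by rewrite (h2 _ _ _ fEb1) (h1 _ _ _ fEb) mono.
  have ab : a = b.
    apply: (hit_inj rot2 ea eb1); apply/eqP; rewrite eqn_leq (first_event_le fa) //=.
    exact: leq_trans le12 le21.
  by move: fE; rewrite ab fEb1.
Qed.

Section Option.
Hypothesis vW2 : v \in W2.

Let ruled2 : ruled W2 rho2 v. Proof. by left. Qed.

Let hit2 b r x : f2 (arc_head b) = Some (r, x) -> hit W2 rho2 v f2 b = r * 2 + ~~ x.
Proof. by rewrite /hit => ->; rewrite /period /slot vW2. Qed.

Let hit1 b r x : arc_tail b = v -> f1 (arc_head b) = Some (r, x) ->
  r * period W1 rho1 v <= hit W1 rho1 v f1 b < r.+1 * period W1 rho1 v.
Proof.
move=> tb; rewrite /hit => ->; rewrite leq_addr mulSn addnC ltn_add2r /=.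
exact: (slot_lt rot1 x tb).
Qed.

Let returns2 r x : returns W2 rho2 v p (r * 2 + ~~ x) = if arc_to v p is Some _ then r + ~~ x else 0.
Proof. by rewrite /returns /period /slot vW2; case: arc_to => // b; case: x => /=; lia. Qed.

Let returns1 T r : r * period W1 rho1 v <= T < r.+1 * period W1 rho1 v ->
  (if arc_to v p is Some _ then r else 0) <= returns W1 rho1 v p T <=
  (if arc_to v p is Some _ then r.+1 else 0).
Proof.
case/andP=> lo hi; rewrite /returns; case Eb: arc_to => [b|] //.
have [tb _] := arc_toP Eb; have := slot_lt rot1 true tb; move: lo hi; rewrite mulSn => lo hi st.
by apply/andP; split; [rewrite leq_divRL | rewrite -ltnS ltn_divLR] => //; rewrite ?mulSn; lia.
Qed.

Lemma lt_of_hit1 a b r x r' y : arc_tail a = v -> arc_tail b = v ->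
  f1 (arc_head a) = Some (r, x) -> f1 (arc_head b) = Some (r', y) ->
  hit W1 rho1 v f1 a <= hit W1 rho1 v f1 b -> r <= r'.
Proof.
move=> ta tb fa fb ab; have /andP[lo _] := hit1 ta fa; have /andP[_ hi] := hit1 tb fb.
have := leq_ltn_trans (leq_trans lo ab) hi; rewrite ltn_pmul2r //.
Qed.

(** Under an actual rotor of period k, a branch with r returns has its time in [r * k, (r + 1) * k):
    smaller [r] come first whatever the slots, and the arc to [p], if any, is taken r or r + 1
    times. The option vertex gets the favourable bound in both cases, r when winning and r + 1 when
    losing. *)
Lemma node_option_ole : ole (node win W1 rho1 p v f1) (node win W2 rho2 p v f2).
Proof.
split=> [r0|r0] /(node_some vs)[a [r [fa fE ->]]]; have /andP[ea _] := fa;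
  have [ta ha _] := event_some ea; have [le1 le2] := le_f ta ha.
- have [r' fE' rr] := le1 _ fE.
  have ea' : event p v f2 a := event_of ta ha fE'.
  have [b fb] := first_event_exists W2 rho2 ea'; have /andP[eb _] := fb.
  have [tb hb [r2 [x fEb]]] := event_some eb.
  have := first_event_le fb ea'; rewrite (hit2 fE') (hit2 fEb).
  rewrite (node_first _ vs ruled2 fb fEb) (hit2 fEb) returns2.
  case: x fEb => fEb /= le; last first.
    have [_ /(_ _ fEb)[r1 fEb1 r12]] := le_f tb hb.
    have eb1 : event p v f1 b := event_of tb hb fEb1.
    have := lt_of_hit1 ta tb fE fEb1 (first_event_le fa eb1); clear -le rr r12; lia.
  eexists; first reflexivity.
  have /andP[lo _] := returns1 (hit1 ta fE).
  by apply: leq_trans lo; case: arc_to => // _; clear -le rr; lia.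
- have [r' fE' rr] := le2 _ fE.
  have ea' : event p v f1 a := event_of ta ha fE'.
  have [b fb] := first_event_exists W1 rho1 ea'; have /andP[eb _] := fb.
  have [tb hb [r2 [x fEb]]] := event_some eb.
  have lt := lt_of_hit1 tb ta fEb fE' (first_event_le fb ea').
  rewrite (node_first _ vs ruled1 fb fEb) (hit2 fE) returns2.
  case: x fEb => fEb.
    have [/(_ _ fEb)[r1 fEb1 r12] _] := le_f tb hb.
    have eb1 : event p v f2 b := event_of tb hb fEb1.
    have := first_event_le fa eb1; rewrite (hit2 fE) (hit2 fEb1) /=; clear -lt rr r12; lia.
  eexists; first reflexivity.
  have /andP[_ hi] := returns1 (hit1 tb fEb).
  by apply: leq_trans hi _; case: arc_to => // _ /=; clear -lt rr; lia.
Qed.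

End Option.

End NodeOrder.

Section Choice.
Variables (R : rotor_graph) (win : vertex R -> bool).
Variables (W : {set vertex R}) (rho1 rho2 : config R) (p v : vertex R).
Variables (f : vertex R -> outcome).
Hypothesis vW : v \in W.

Definition winning_event a := first_event W rho2 p v f a && if f (arc_head a) is Some (_, x) then x else false.

(** A winning branch among the earliest events is placed at slot 0; failing that, the arc to [p] is,
    which earns the extra return. The last case merely supplies an outgoing arc, since a strategy
    must be defined on all option vertices. *)
Definition choice : option (arcs R) :=
  if [pick a | winning_event a] is Some a then Some a
  else if arc_to v p is Some b then Some b else [pick a | arc_tail a == v].

Lemma node_choice a0 : rotor_at set0 rho1 v a0 -> choice = Some a0 ->
  node win set0 rho1 p v f = node win W rho2 p v f.
Proof.
move=> rot cE; have [vs _ _ t0] := rot.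
have le_f a : arc_tail a = v -> arc_head a != p -> ole (f (arc_head a)) (f (arc_head a)).
  by move=> _ _; apply: ole_refl.
apply: ole_anti; first by have := @node_option_ole R win set0 W rho1 rho2 p v f f le_f a0 rot vW.
have ruled1 : ruled set0 rho1 v by right; exists a0.
have ruled2 : ruled W rho2 v by left.
have hit2 b r x : f (arc_head b) = Some (r, x) -> hit W rho2 v f b = r * 2 + ~~ x.
  by rewrite /hit => ->; rewrite /period /slot vW.
have p2 : period W rho2 v = 2 by rewrite /period vW.
have s2 b : slot W rho2 v true b = 0 by rewrite /slot vW.
have k0 : 0 < period set0 rho1 v by apply: leq_ltn_trans (slot_lt rot true t0).
have h1 b r x : f (arc_head b) = Some (r, x) ->
    hit set0 rho1 v f b = r * period set0 rho1 v + slot set0 rho1 v x b.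
  by rewrite /hit => ->.
split=> [r0|r0] /(node_some vs)[a [r [fa fE ->]]]; have /andP[ea _] := fa;
  have [ta ha _] := event_some ea.
- have : winning_event a by rewrite /winning_event fa fE.
  move: cE; rewrite /choice; case: pickP => [b wb [bE]|->] // _.
  rewrite bE in wb; have /andP[f0] := wb; case fE0: (f _) => [[r1 x]|] // xt; rewrite xt in fE0.
  have /andP[e0 _] := f0.
  have f01 : first_event set0 rho1 p v f a0.
    rewrite /first_event e0; apply/forallP => c; apply/implyP => ec.
    have [tc hc [r2 [y fEc]]] := event_some ec.
    have := first_event_le f0 ec; rewrite (hit2 _ _ _ fE0) (hit2 _ _ _ fEc) => le.
    rewrite (h1 _ _ _ fE0) (h1 _ _ _ fEc) (slot0 rot) addn0.
    by apply: leq_trans (leq_addr _ _); rewrite leq_mul2r; move: le; clear; case: y => /=; lia.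
  rewrite (node_first _ vs ruled1 f01 fE0); eexists; first reflexivity.
  have := first_event_le f0 ea; rewrite (hit2 _ _ _ fE0) (hit2 _ _ _ fE) => le.
  rewrite /returns (h1 _ _ _ fE0) (slot0 rot) addn0; case: arc_to => // d.
  rewrite p2 s2 divnMDl // divn_small ?addn0; last by move: k0; clear; lia.
  by move: le; clear; rewrite /=; lia.
- have [b fb] := first_event_exists W rho2 ea; have /andP[eb _] := fb.
  have [tb hb [r2 [x fEb]]] := event_some eb.
  have := first_event_le fb ea; rewrite (hit2 _ _ _ fE) (hit2 _ _ _ fEb) => lba.
  have lab := first_event_le fa eb; rewrite (h1 _ _ _ fE) (h1 _ _ _ fEb) in lab.
  have sa := slot_lt rot false ta.
  have rr : r <= r2.
    rewrite -ltnS -(ltn_pmul2r k0); apply: leq_ltn_trans (leq_addr _ _) (leq_ltn_trans lab _).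
    have := slot_lt rot x tb; rewrite mulSn; clear; lia.
  rewrite (node_first _ vs ruled2 fb fEb) (hit2 _ _ _ fEb).
  have re : r2 = r by move: lba rr; clear; case: x => /=; lia.
  rewrite re in fEb lba lab.
  have winE c : winning_event c -> f (arc_head c) = Some (r, true) /\ x = true.
    case/andP=> fc; case fEc: (f _) => [[rc y]|] // yt; rewrite yt in fEc.
    have /andP[ec _] := fc.
    have := first_event_le fc eb; have := first_event_le fb ec.
    rewrite (hit2 _ _ _ fEc) (hit2 _ _ _ fEb) ?yt => l1 l2.
    have [-> ->] : rc = r /\ x = true; last by [].
    by move: l1 l2; clear; case: x => /=; lia.
  (* If the earliest event of the option vertex were winning, the choice would give it slot 0, and
     it would precede the losing event [a]. *)
  case: x fEb lba lab winE => /= fEb lba lab winE.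
    have wb : winning_event b by rewrite /winning_event fb fEb.
    move: cE; rewrite /choice; case: pickP => [c wc [cE]|/(_ b)]; last by rewrite wb.
    rewrite cE in wc; have /andP[/andP[e0 _] _] := wc; have [fE0 _] := winE _ wc.
    have := first_event_le fa e0; rewrite (h1 _ _ _ fE) (h1 _ _ _ fE0) (slot0 rot) addn0 => le0.
    suff aE : a = a0 by move: fE; rewrite aE fE0.
    by apply: (slot_inj rot (x := false) (y := false)) => //; rewrite (slot0 rot); move: le0; clear; lia.
  eexists; first reflexivity.
  rewrite (h1 _ _ _ fE) /returns; case Eb: arc_to => [c|] //.
  have cE0 : c = a0.
    by move: cE; rewrite /choice; case: pickP => [d /winE[]//|_]; rewrite Eb => -[].
  have [_ h0] := arc_toP Eb; rewrite cE0 in h0 *.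
  (* Slot 0 belongs to the arc to [p], so the losing branch has a positive slot, which rounds the
     number of returns up to r + 1. *)
  have s0 : 0 < slot set0 rho1 v false a.
    rewrite lt0n; apply: contraNneq ha => sa0; rewrite -h0; apply/eqP; congr arc_head.
    by apply: (slot_inj rot (x := false) (y := false)) => //; rewrite (slot0 rot).
  rewrite p2 s2 (slot0 rot) !subn0 leq_divRL // re; move: s0 k0; clear.
  have -> : (r * 2 + ~~ false + 2.-1) %/ 2 = r.+1 by rewrite /=; lia.
  by rewrite mulSn; lia.
Qed.

End Choice.

(** * Optimal values from the outcomes of directed edges *)

Section Game.
Variable G : rotor_game.
Hypothesis treeG : tree_like G.
Hypothesis stopG : stopping G.
Hypothesis simple : simple_digraph G.
Hypothesis binary : binary_values G.
Implicit Types (p u v : vertex G) (sigma : config G).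

Local Notation branch := (branch (@adj G)).

Definition win v := value v == 1.

(** Neither a strategy nor a start enters: this is an upper bound for all strategies, attained on
    the branches that do not contain [u] by the strategy built for the start [u]. *)
Definition best_outcome p v := branch_outcome win (Vmax G) (rho0 G) p v.

Let strategy_outcome sigma p v := branch_outcome win set0 (join_config sigma) p v.

Lemma vertex_cases v : v \notin sinks G ->
  (v \in Vmax G /\ v \notin Vr G) \/ (v \in Vr G /\ v \notin Vmax G).
Proof.
move=> vs; have : v \in Vr G :|: Vmax G by rewrite V0_split inE.
rewrite inE; case: (boolP (v \in Vr G)) => [vr _|_ /= vm]; last by left.
by right; split=> //; rewrite (disjointFr (Vr_Vmax_disjoint G) vr).
Qed.

Lemma rho0_rotor v : v \notin sinks G -> v \notin Vmax G ->
  exists2 a, rho0 G v = Some a & rotor_at (Vmax G) (rho0 G) v a.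
Proof.
move=> vs vm; have [[]|[vr _]] := vertex_cases vs; first by rewrite (negPf vm).
have := rho0_config v; case E: (rho0 G v) => [a|]; last by rewrite vr.
by case=> _ ta; exists a.
Qed.

Lemma rho0_ruled v : v \notin sinks G -> ruled (Vmax G) (rho0 G) v.
Proof.
move=> vs; case: (boolP (v \in Vmax G)) => vm; first by left.
by right; have [a _ rot] := rho0_rotor vs vm; exists a.
Qed.

Lemma join_rotor sigma v a : v \notin sinks G -> v \notin Vmax G -> rho0 G v = Some a ->
  arc_tail a = v -> rotor_at set0 (join_config sigma) v a.
Proof. by move=> vs vm E ta; split; rewrite ?inE ?ffunE ?(negPf vm). Qed.

Lemma join_total sigma : strategy sigma -> total_config (join_config sigma).
Proof.
move=> st v vs; case: (boolP (v \in Vmax G)) => vm; last first.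
  have [a E [_ _ _ ta]] := rho0_rotor vs vm; exists a; exact: join_rotor.
have := st v; case E: (sigma v) => [a|]; last by rewrite vm.
by case=> _ ta; exists a; split; rewrite ?inE ?ffunE ?vm.
Qed.

Lemma strategy_node_ole sigma p v : strategy sigma ->
  (forall a, arc_tail a = v -> arc_head a != p ->
     ole (strategy_outcome sigma v (arc_head a)) (best_outcome v (arc_head a))) ->
  ole (node win set0 (join_config sigma) p v (strategy_outcome sigma v))
      (node win (Vmax G) (rho0 G) p v (best_outcome v)).
Proof.
move=> st le; case: (boolP (v \in sinks G)) => vs; first by rewrite /node vs; apply: ole_refl.
case: (boolP (v \in Vmax G)) => vm.
  have [a rot] := join_total st vs.
  exact: (node_option_ole (f1 := strategy_outcome sigma v) win (rho0 G) le rot vm).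
have [a E rot] := rho0_rotor vs vm; have [_ _ _ ta] := rot.
exact: (node_rotor_ole (f1 := strategy_outcome sigma v) win le (join_rotor sigma vs vm E ta) rot).
Qed.

Lemma strategy_outcome_ole sigma p v : strategy sigma -> adj p v ->
  ole (strategy_outcome sigma p v) (best_outcome p v).
Proof.
move=> st pv; elim/(branch_ind treeG): pv => {}p {}v pv IH.
rewrite /strategy_outcome /best_outcome !branch_outcomeE //.
by apply: strategy_node_ole => // a ta ha; apply: IH => //; apply: adj_head.
Qed.

Section BestStrategy.
Variable u : vertex G.

(** The neighbour from which [v] is judged when the walk starts at [u]. Making [u] its own parent
    selects the root instance of [node]; in a connected graph the default of [odflt] is never taken
    for another vertex. *)
Definition parent v := if v == u then u else odflt u [pick q | adj v q && (u \in branch v q)].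

Definition best_strategy : config G :=
  [ffun v => if v \in Vmax G
             then choice (Vmax G) (rho0 G) (parent v) v (best_outcome v) else None].

Lemma choice_tail p v f a : choice (Vmax G) (rho0 G) p v f = Some a -> arc_tail a = v.
Proof.
rewrite /choice; case: pickP => [b /andP[/andP[/and3P[/eqP tb _ _] _] _] [<-] //|_].
case E: (arc_to v p) => [b|]; first by case=> <-; case: (arc_toP E).
by case: pickP => // b /eqP tb [<-].
Qed.

Lemma best_strategyP : strategy best_strategy.
Proof.
move=> v; rewrite ffunE; case: (boolP (v \in Vmax G)) => // vm.
case E: choice => [a|]; first by split=> //; apply: choice_tail E.
have vs : v \notin sinks G.
  by rewrite -in_setC -V0_split inE vm orbT.
have [b /and3P[tb _ _]] := root_event treeG stopG win (Vmax G) (rho0 G) vs.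
move: E; rewrite /choice; case: pickP => // _; case: arc_to => //.
by case: pickP => // /(_ b); rewrite tb.
Qed.

Lemma best_strategy_node p v : p = parent v ->
  (forall a, arc_tail a = v -> arc_head a != p ->
     strategy_outcome best_strategy v (arc_head a) = best_outcome v (arc_head a)) ->
  node win set0 (join_config best_strategy) p v (strategy_outcome best_strategy v) =
  node win (Vmax G) (rho0 G) p v (best_outcome v).
Proof.
move=> pE eq_out; rewrite (eq_node (rho' := join_config best_strategy) _ (fun _ => erefl) eq_out).
case: (boolP (v \in sinks G)) => vs; first by rewrite /node vs.
have le a : arc_tail a = v -> arc_head a != p ->
    ole (best_outcome v (arc_head a)) (best_outcome v (arc_head a)).
  by move=> _ _; apply: ole_refl.
case: (boolP (v \in Vmax G)) => vm; last first.
  have [a E rot] := rho0_rotor vs vm; have [_ _ _ ta] := rot.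
  have rot' := join_rotor best_strategy vs vm E ta.
  apply: ole_anti.
    exact: (node_rotor_ole (f1 := best_outcome v) win le rot' rot).
  exact: (node_rotor_ole (f1 := best_outcome v) win le rot rot').
have [a rot] := join_total best_strategyP vs; have [_ _ jE _] := rot.
apply: (node_choice win vm rot).
by move: jE; rewrite !ffunE vm -pE.
Qed.

Lemma parentE p v : adj p v -> u \notin branch p v -> p = parent v.
Proof.
move=> pv nu; have uv : u != v by apply: contraNneq nu => ->; apply: branch_refl.
rewrite /parent eq_sym (negPf uv).
have con : connect (@adj G) v u by case: treeG => -[].
have [c vc uc] := branch_cover con uv.
have cp : c = p.
  apply: contraNeq nu => cp; apply: subsetP uc; exact: adj_branch_sub.
case: pickP => [q /andP[vq uq]|/(_ c)]; last by rewrite vc uc.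
by rewrite /= -cp; apply: (adj_branch_disjoint treeG vc vq uc uq).
Qed.

Lemma best_strategy_outcome p v : adj p v -> u \notin branch p v ->
  strategy_outcome best_strategy p v = best_outcome p v.
Proof.
move=> pv; elim/(branch_ind treeG): pv => {}p {}v pv IH nu.
rewrite /strategy_outcome /best_outcome !branch_outcomeE //.
apply: best_strategy_node => [|a ta ha]; first exact: parentE.
have va := adj_head ta; apply: IH => //.
by apply: contraNN nu; apply: subsetP; apply: adj_branch_sub.
Qed.

End BestStrategy.

Lemma sink_value s : s \in sinks G -> value s = win s.
Proof. by move/binary; rewrite !inE /win => /orP[] /eqP ->. Qed.

Lemma maximal_walk_sink (rho : config G) v s : maximal_walk rho v s -> s \in sinks G.
Proof. by elim. Qed.

Lemma optimal_outcome u : exists r x,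
  node win (Vmax G) (rho0 G) u u (best_outcome u) = Some (r, x) /\ optimal_value u (x : nat).
Proof.
have tot := join_total (best_strategyP u).
have [r [x [nE [s ws sx]]]] := root_walk treeG stopG simple win u tot.
rewrite best_strategy_node in nE; first last.
- by move=> a ta _; apply: best_strategy_outcome; [apply: adj_head | apply: adj_branch_root; apply: adj_head].
- by rewrite /parent eqxx.
exists r, x; split=> //; split.
  exists (best_strategy u); first exact: best_strategyP.
  by exists s => //; rewrite (sink_value (maximal_walk_sink ws)) sx.
move=> sigma y st [s' ws' <-].
have [r' [x' [nE' [s2 ws2 sx2]]]] := root_walk treeG stopG simple win u (join_total st).
rewrite (maximal_walk_unique ws' ws2) (sink_value (maximal_walk_sink ws2)) sx2.
(* With values 0 and 1 it is enough that a winning strategy forces [x] to be [true], which is the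
   first half of [ole]. *)
have [] := @strategy_node_ole sigma u u st (fun a ta _ => strategy_outcome_ole st (adj_head ta)).
rewrite /strategy_outcome nE nE'; case: x' {sx2 nE'} => // /(_ r' erefl)[r2 [_ ->]] //.
Qed.

End Game.

(** * Execution of programs *)

(** Bounds the time of loop-free code; charging both branches of a test makes it independent of the
    state. The value on loops is a dummy, as [wp] is [False] there. *)
Fixpoint weight c : nat :=
  match c with
  | Skip => 1
  | Assign _ e => (cost e).+1
  | Store _ i e => (cost i + cost e).+1
  | Seq c1 c2 => weight c1 + weight c2
  | If e c1 c2 => (cost e + (weight c1 + weight c2)).+1
  | While _ _ => 0
  end.

Fixpoint wp c (Q : state -> Prop) s : Prop :=
  match c with
  | Skip => Q s
  | Assign r e => Q (set_reg s r (eval s e))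
  | Store A i e => Q (set_cell s A (eval s i) (eval s e))
  | Seq c1 c2 => wp c1 (wp c2 Q) s
  | If e c1 c2 => if eval s e != 0 then wp c1 Q s else wp c2 Q s
  | While _ _ => False
  end.

Fixpoint wregs c : seq nat :=
  match c with
  | Assign r _ => [:: r]
  | Seq c1 c2 | If _ c1 c2 => wregs c1 ++ wregs c2
  | While _ c => wregs c
  | _ => [::]
  end.

Fixpoint warrs c : seq nat :=
  match c with
  | Store A _ _ => [:: A]
  | Seq c1 c2 | If _ c1 c2 => warrs c1 ++ warrs c2
  | While _ c => warrs c
  | _ => [::]
  end.

Definition frame c s s' :=
  (forall r, r \notin wregs c -> reg s' r = reg s r) /\
  (forall A, A \notin warrs c -> cell s' A = cell s A).

Lemma frame_trans c s1 s2 s3 : frame c s1 s2 -> frame c s2 s3 -> frame c s1 s3.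
Proof.
by case=> r12 c12 [r23 c23]; split=> x nx; rewrite ?r23 ?c23 ?r12 ?c12.
Qed.

Lemma frame_weaken c c' s s' : {subset wregs c <= wregs c'} -> {subset warrs c <= warrs c'} ->
  frame c s s' -> frame c' s s'.
Proof.
move=> sr sa [fr fc]; split=> x nx.
  by apply: fr; apply: contra nx; apply: sr.
by apply: fc; apply: contra nx; apply: sa.
Qed.

Lemma exec_frame c s t s' : exec c s t s' -> frame c s s'.
Proof.
elim=> {c s t s'} //.
- by move=> s r e; split=> // x; rewrite inE /= /upd => /negPf ->.
- by move=> s A i e; split=> // x; rewrite inE /= /upd => /negPf ->.
- move=> c1 c2 s1 t1 s2 t2 s3 _ f1 _ f2; apply: (frame_trans (s2 := s2)).
    by apply: frame_weaken f1 => x /= xc; rewrite mem_cat xc.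
  by apply: frame_weaken f2 => x /= xc; rewrite mem_cat xc orbT.
- move=> e c1 c2 s t s' _; case: ifP => _; apply: frame_weaken => x /= xc;
    by rewrite mem_cat xc ?orbT.
- by move=> e c s1 t1 s2 t2 s3 _ _ f1 _ f2; apply: (frame_trans f1).
Qed.

Definition halts c s B (Q : state -> Prop) := exists t s', [/\ exec c s t s', t <= B & Q s'].

Lemma halts_wp c Q s : wp c Q s -> halts c s (weight c) Q.
Proof.
elim: c Q s => [|r e|A i e|c1 IH1 c2 IH2|e c1 IH1 c2 IH2|//] Q s /=.
- by move=> Qs; exists 1, s; split=> //; constructor.
- by move=> Qs; do 2!eexists; split; [constructor| |exact: Qs].
- by move=> Qs; do 2!eexists; split; [constructor| |exact: Qs].
- case/IH1=> t1 [s1 [x1 l1 /IH2[t2 [s2 [x2 l2 Qs]]]]].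
  by exists (t1 + t2), s2; split; [apply: exec_seq x1 x2|apply: leq_add|].
- move=> H; have [t [s' [x l Qs]]] : halts (if eval s e != 0 then c1 else c2) s (weight c1 + weight c2) Q.
    case: ifP H => _ => [/IH1|/IH2] [t [s' [x l Qs]]]; exists t, s'; split=> //.
      exact: leq_trans l (leq_addr _ _).
    exact: leq_trans l (leq_addl _ _).
  by exists (cost e + t).+1, s'; split; [constructor| rewrite ltnS leq_add2l|].
Qed.

Lemma halts_mono c s B B' (Q Q' : state -> Prop) : halts c s B Q -> B <= B' ->
  (forall s', frame c s s' -> Q s' -> Q' s') -> halts c s B' Q'.
Proof.
case=> t [s' [x l Qs]] BB QQ; exists t, s'; split=> //; first exact: leq_trans BB.
by apply: QQ => //; apply: exec_frame x.
Qed.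

Lemma halts_seq c1 c2 s B1 B2 (Q1 Q : state -> Prop) : halts c1 s B1 Q1 ->
  (forall s', frame c1 s s' -> Q1 s' -> halts c2 s' B2 Q) -> halts (Seq c1 c2) s (B1 + B2) Q.
Proof.
case=> t1 [s1 [x1 l1 Q1s]] /(_ s1 (exec_frame x1) Q1s)[t2 [s2 [x2 l2 Qs]]].
by exists (t1 + t2), s2; split; [apply: exec_seq x1 x2|apply: leq_add|].
Qed.

(** [k] bounds the number of remaining iterations. *)
Lemma halts_while e c (I : nat -> state -> Prop) k s : I k s ->
  (forall k' s', frame c s s' -> I k' s' -> eval s' e != 0 ->
     wp c (fun s2 => exists2 k2, k2 < k' & I k2 s2) s') ->
  halts (While e c) s (k.+1 * (cost e + weight c).+1)
    (fun s' => (exists k', I k' s') /\ eval s' e = 0).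
Proof.
move=> Iks step.
suff H : forall s', frame c s s' -> I k s' -> halts (While e c) s' (k.+1 * (cost e + weight c).+1)
    (fun s' => (exists k', I k' s') /\ eval s' e = 0) by apply: H.
elim/ltn_ind: k {Iks} => k IH s1 fs1 Ik; case: (eqVneq (eval s1 e) 0) => ev.
  exists (cost e).+1, s1; split; [exact: exec_while_stop | | by split=> //; exists k].
  by rewrite mulSn; apply: leq_trans (leq_addr _ _); rewrite ltnS leq_addr.
have [t1 [s2 [x1 l1 [k2 lk Ik2]]]] := halts_wp (step _ _ fs1 Ik ev).
have fs2 := frame_trans fs1 (exec_frame x1).
have [t2 [s3 [x2 l2 Q3]]] := IH _ lk _ fs2 Ik2.
exists (cost e + t1 + t2).+1, s3; split => //; first exact: exec_while_loop ev x1 x2.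
rewrite -addSn mulSn; apply: leq_add; first by rewrite ltnS leq_add2l.
by apply: leq_trans l2 _; rewrite leq_mul2r lk orbT.
Qed.

Lemma wp_mono c (Q Q' : state -> Prop) s : (forall s', Q s' -> Q' s') -> wp c Q s -> wp c Q' s.
Proof.
elim: c Q Q' s => [|r e|A i e|c1 IH1 c2 IH2|e c1 IH1 c2 IH2|//] Q Q' s QQ /=; try exact: QQ.
  by apply: IH1 => s'; apply: IH2.
by case: ifP => _; [apply: IH1 | apply: IH2].
Qed.

Lemma wp_frame c Q s : wp c Q s -> wp c (fun s' => frame c s s' /\ Q s') s.
Proof.
suff H s0 Q0 : wp c Q0 s0 -> wp c (fun s' => frame c s0 s' /\ Q0 s') s0 by apply: H.
elim: c s0 Q0 => [|r e|A i e|c1 IH1 c2 IH2|e c1 IH1 c2 IH2|//] s0 Q0 /=.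
- by [].
- by split=> //; apply: (exec_frame (exec_assign s0 r e)).
- by split=> //; apply: (exec_frame (exec_store s0 A i e)).
- move=> /IH1; apply: wp_mono => s1 [f1 /IH2]; apply: wp_mono => s2 [f2 Q2]; split=> //.
  apply: (frame_trans (s2 := s1)).
    by apply: frame_weaken f1 => x /= xc; rewrite mem_cat xc.
  by apply: frame_weaken f2 => x /= xc; rewrite mem_cat xc orbT.
- case: ifP => _ => [/IH1|/IH2]; apply: wp_mono => s2 [f2 Q2]; split=> //;
    apply: frame_weaken f2 => x /= xc; by rewrite mem_cat xc ?orbT.
Qed.

Lemma wp_seq c1 c2 (Q1 Q : state -> Prop) s : wp c1 Q1 s ->
  (forall s', frame c1 s s' -> Q1 s' -> wp c2 Q s') -> wp (Seq c1 c2) Q s.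
Proof. by move=> /wp_frame w1 w2 /=; apply: wp_mono w1 => s' [f1 q1]; apply: w2. Qed.

Definition Lt e1 e2 := IsLeq (Plus e1 (Const 1)) e2.

Lemma eval_Lt s e1 e2 : eval s (Lt e1 e2) = (eval s e1 < eval s e2).
Proof. by rewrite /= addn1. Qed.

(** The initialisation is charged to every round, so that the time of a phase is at most a number of
    rounds times a constant. *)
Definition loop_cost init e c := weight init + (cost e + weight c).+1.

Lemma halts_loop init e c (I : nat -> state -> Prop) k s : wp init (I k) s ->
  (forall k' s', frame (Seq init c) s s' -> I k' s' -> eval s' e != 0 ->
     wp c (fun s2 => exists2 k2, k2 < k' & I k2 s2) s') ->
  halts (Seq init (While e c)) s (k.+1 * loop_cost init e c)
    (fun s' => (exists k', I k' s') /\ eval s' e = 0).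
Proof.
move=> wi step; have hi := halts_wp wi.
have K s1 : frame init s s1 -> I k s1 -> halts (While e c) s1 (k.+1 * (cost e + weight c).+1)
    (fun s' => (exists k', I k' s') /\ eval s' e = 0).
  move=> f1 I1; apply: halts_while => // k' s' f'; apply: step.
  apply: (frame_trans (s2 := s1)).
    by apply: frame_weaken f1 => x /= xc; rewrite mem_cat xc.
  by apply: frame_weaken f' => x /= xc; rewrite mem_cat xc orbT.
apply: halts_mono (halts_seq hi K) _ _ => //.
by rewrite mulnDr leq_add2r mulSn leq_addr.
Qed.

Lemma neq0_bool (b : bool) : ((b : nat) != 0) = b.
Proof. by case: b. Qed.

Lemma ltn_subS n i : i < n -> n - i.+1 < n - i.
Proof. lia. Qed.

Lemma wp_if e c1 c2 (Q : state -> Prop) s : (eval s e != 0 -> wp c1 Q s) ->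
  (eval s e = 0 -> wp c2 Q s) -> wp (If e c1 c2) Q s.
Proof. by move=> H1 H2 /=; case: ifPn => [|/negPn/eqP]. Qed.

(** * Numbering and tables *)

Definition code (T : finType) (x : T) : nat := enum_rank x.

Lemma code_lt (T : finType) (x : T) : code x < #|T|.
Proof. exact: ltn_ord. Qed.

Lemma code_inj (T : finType) : injective (@code T).
Proof. by move=> x y /ord_inj /enum_rank_inj. Qed.

Lemma code_eq (T : finType) (x y : T) : (code x == code y) = (x == y).
Proof. exact: (inj_eq (@code_inj T)). Qed.

Lemma code_ex (T : finType) i : i < #|T| -> exists x : T, code x = i.
Proof. by move=> lt; exists (enum_val (Ordinal lt)); rewrite /code enum_valK. Qed.

Lemma table_code (T : finType) (f : T -> nat) x : table f (code x) = f x.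
Proof. by rewrite /table /code nth_codom enum_rankK. Qed.

Notation Akind := 0 (only parsing).
Notation Avalue := 1 (only parsing).
Notation Arotor := 2 (only parsing).
Notation Ahead := 3 (only parsing).
Notation Atail := 4 (only parsing).
Notation Atheta := 5 (only parsing).
(* [Amult] holds the multiples of the number of vertices, and [Aarc] the
   adjacency matrix in row-major order, with entries as in [vertex_rotor]. *)
Notation Amult := 7 (only parsing).
Notation Aarc := 8 (only parsing).
Notation Aslot := 9 (only parsing).
Notation Adeg := 10 (only parsing).
Notation Asum := 11 (only parsing).

Notation Incr r := (Assign r (Plus (Reg r) (Const 1))).

(** The offsets of the matrix rows are obtained by repeated addition, as the machine does not
    multiply. *)
Definition multiples_body :=
  Seq (Store Amult (Plus (Reg 2) (Const 1)) (Plus (Cell Amult (Reg 2)) (Reg 0)))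
      (Incr 2).

Definition multiples_loop := Seq (Assign 2 (Const 0)) (While (Lt (Reg 2) (Reg 0)) multiples_body).

Definition pair_cell A u v := Cell A (Plus (Cell Amult u) v).

(** Degrees and sums of neighbour numbers stand in for adjacency lists: at a leaf the sum is the
    neighbour itself, and deleting an edge is a subtraction. *)
Definition add_neighbor t h :=
  Seq (Store Adeg t (Plus (Cell Adeg t) (Const 1))) (Store Asum t (Plus (Cell Asum t) h)).

(** An edge carrying arcs in both directions must count once: it is added only while the reverse arc
    is absent from the matrix. *)
Definition load_body :=
  Seq (Assign 3 (Cell Atail (Reg 2)))
 (Seq (Assign 4 (Cell Ahead (Reg 2)))
 (Seq (If (IsEq (pair_cell Aarc (Reg 4) (Reg 3)) (Const 0))
          (Seq (add_neighbor (Reg 3) (Reg 4)) (add_neighbor (Reg 4) (Reg 3)))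
          Skip)
 (Seq (Store Aarc (Plus (Cell Amult (Reg 3)) (Reg 4)) (Plus (Reg 2) (Const 1)))
      (Incr 2)))).

Definition load_loop := Seq (Assign 2 (Const 0)) (While (Lt (Reg 2) (Reg 1)) load_body).

(** Serves in both directions: to add an edge while arcs are loaded, and to delete one when a leaf
    is peeled. *)
Lemma sum_add_edge (V : finType) (E E' : rel V) t h (F : V -> nat) :
  t != h -> ~~ E t h -> ~~ E h t ->
  (forall u v, E' u v = [|| E u v, (u == t) && (v == h) | (u == h) && (v == t)]) ->
  forall u, \sum_(v | E' u v) F v =
    \sum_(v | E u v) F v + ((u == t) * F h + (u == h) * F t).
Proof.
move=> th Eth Eht E'E u.
have K (P : pred V) x : ~~ P x -> \sum_(v | P v || (v == x)) F v = \sum_(v | P v) F v + F x.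
  move=> Px; rewrite (bigD1 x) ?eqxx ?orbT //= addnC; congr (_ + _).
  apply: eq_bigl => v; case: eqVneq => [->|_] /=; first by rewrite (negPf Px) andbF.
  by rewrite orbF andbT.
case: (eqVneq u t) => [->|ut].
  rewrite (negPf th) mul1n mul0n addn0 -K //; apply: eq_bigl => v.
  by rewrite E'E eqxx (negPf th) /= orbF.
case: (eqVneq u h) => [->|uh].
  rewrite mul1n mul0n add0n -K //; apply: eq_bigl => v.
  by rewrite E'E eqxx eq_sym (negPf th).
rewrite !mul0n !addn0; apply: eq_bigl => v.
by rewrite E'E (negPf ut) (negPf uh) !orbF.
Qed.

Section Phases.
Variable G : rotor_game.
Implicit Types (u v w : vertex G) (a b : arcs G) (s : state).

Local Notation n := #|vertex G|.
Local Notation m := #|arcs G|.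

Record input s : Prop := Input {
  input_n : reg s 0 = n;
  input_m : reg s 1 = m;
  input_kind : forall u, cell s Akind (code u) = vertex_kind u;
  input_value : forall u, cell s Avalue (code u) = vertex_value u;
  input_rotor : forall u, cell s Arotor (code u) = vertex_rotor u;
  input_head : forall a, cell s Ahead (code a) = code (arc_head a);
  input_tail : forall a, cell s Atail (code a) = code (arc_tail a);
  input_theta : forall a, cell s Atheta (code a) = code (theta a) }.

Lemma input_input_state : input (input_state G).
Proof. by split=> //= x; rewrite table_code. Qed.

Lemma input_frame c s s' : all (fun r => r \notin wregs c) [:: 0; 1] ->
  all (fun A => A \notin warrs c) (iota 0 6) -> frame c s s' -> input s -> input s'.
Proof.
case/and3P=> r0 r1 _ /and5P[a0 a1 a2 a3 /and3P[a4 a5 _]] [fr fc] [].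
by split; rewrite ?fr ?fc.
Qed.

Definition multiples s := forall i, i <= n -> cell s Amult i = i * n.

Definition zeros A s := forall i, cell s A i = 0.

Lemma multiples_halts s : input s -> zeros Amult s ->
  halts multiples_loop s (n.+1 * loop_cost (Assign 2 (Const 0)) (Lt (Reg 2) (Reg 0)) multiples_body)
    multiples.
Proof.
move=> ins z; pose I k s' := exists i, [/\ reg s' 2 = i, k = n - i, i <= n
  & forall j, j <= i -> cell s' Amult j = j * n].
have I0 : wp (Assign 2 (Const 0)) (I n) s.
  exists 0; split=> //=; first by rewrite subn0.
  by move=> j; rewrite leqn0 => /eqP ->; rewrite z.
apply: halts_mono (halts_loop I0 _) _ _ => // [k s1 f1 [i [r2 -> lei cE]]|s1 f1 [[k [i [r2 _ lei cE]]]]].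
  have n1 : reg s1 0 = n by apply: input_n; apply: input_frame f1 ins.
  rewrite eval_Lt /= r2 n1 neq0_bool => lt.
  exists (n - i.+1); first exact: ltn_subS.
  exists i.+1; rewrite /set_reg /set_cell /= /upd /= addn1; split=> // j le.
  case: eqVneq => [->|ji]; first by rewrite cE // mulSn addnC.
  by rewrite cE // -ltnS ltn_neqAle ji.
have n1 : reg s1 0 = n by apply: input_n; apply: input_frame f1 ins.
rewrite eval_Lt /= r2 n1 => /eqP; rewrite eqb0 -leqNgt => ge j le; apply: cE.
exact: leq_trans le ge.
Qed.

Lemma pair_code_eq u v u' v' :
  (code u * n + code v == code u' * n + code v') = (u == u') && (v == v').
Proof.
apply/eqP/andP => [E|[/eqP -> /eqP ->] //].
have n0 : 0 < n by apply: leq_ltn_trans (code_lt u).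
have := congr1 (divn^~ n) E; have := congr1 (modn^~ n) E.
rewrite !modnMDl !divnMDl // !modn_small ?divn_small ?code_lt // !addn0.
by move=> /code_inj -> /code_inj ->.
Qed.

Definition pair_table (A : nat) s (f : vertex G -> vertex G -> nat) :=
  forall u v, cell s A (code u * n + code v) = f u v.

Definition arc_index u v := if arc_to u v is Some a then (code a).+1 else 0.

Definition degrees (E : rel (vertex G)) s :=
  (forall u, cell s Adeg (code u) = \sum_(v | E u v) 1) /\
  (forall u, cell s Asum (code u) = \sum_(v | E u v) code v).

Lemma degrees_ext E E' s : E =2 E' -> degrees E s -> degrees E' s.
Proof.
move=> EE [d1 d2]; split=> u; rewrite ?d1 ?d2; apply: eq_bigl => v; exact: EE.
Qed.

Lemma add_edge_wp (E E' : rel (vertex G)) t h s : reg s 3 = code t -> reg s 4 = code h ->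
  t != h -> ~~ E t h -> ~~ E h t ->
  (forall u v, E' u v = [|| E u v, (u == t) && (v == h) | (u == h) && (v == t)]) ->
  degrees E s ->
  wp (Seq (add_neighbor (Reg 3) (Reg 4)) (add_neighbor (Reg 4) (Reg 3))) (degrees E') s.
Proof.
move=> r3 r4 th Eth Eht E'E [d1 d2]; have sumE := sum_add_edge _ th Eth Eht E'E.
rewrite /= /set_cell /= /upd /= r3 r4; split=> u /=.
all: rewrite sumE !code_eq [h == t]eq_sym (negPf th).
all: case: (eqVneq u h) => [->|uh]; first by rewrite eq_sym (negPf th) ?d1 ?d2 ?mul1n.
all: by case: (eqVneq u t) => [->|ut]; rewrite ?d1 ?d2 ?mul1n ?addn0.
Qed.

Section Load.
Hypothesis simple : simple_digraph G.

Definition loaded_arc i u v :=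
  if arc_to u v is Some a then if code a < i then (code a).+1 else 0 else 0.

Definition loaded_edge i u v := (loaded_arc i u v != 0) || (loaded_arc i v u != 0).

Lemma loaded_arcS a u v : loaded_arc (code a).+1 u v =
  if (u == arc_tail a) && (v == arc_head a) then (code a).+1 else loaded_arc (code a) u v.
Proof.
rewrite /loaded_arc; case: ifP => [/andP[/eqP -> /eqP ->]|ne].
  by rewrite (arc_to_head simple) // ltnSn.
case E: (arc_to u v) => [b|] //; rewrite ltnS leq_eqVlt code_eq.
case: eqVneq => [ba|] //; have [tb hb] := arc_toP E.
by rewrite -tb -hb ba !eqxx in ne.
Qed.

Lemma loaded_edgeE i u v : i >= m -> loaded_edge i u v = adj u v.
Proof.
move=> im; have K x y : (loaded_arc i x y != 0) = arc_rel x y.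
  rewrite /loaded_arc /arc_rel; case E: (arc_to x y) => [a|].
    rewrite (leq_trans (code_lt a) im) /=; apply/esym/existsP; exists a.
    by have [-> ->] := arc_toP E; rewrite !eqxx.
  apply/esym/existsP => -[b /andP[/eqP tb /eqP hb]].
  by move: E; rewrite -tb (arc_to_head simple hb).
by rewrite /loaded_edge !K.
Qed.

Lemma loaded_arcE i u v : i >= m -> loaded_arc i u v = arc_index u v.
Proof.
move=> im; rewrite /loaded_arc /arc_index; case: arc_to => // a.
by rewrite (leq_trans (code_lt a) im).
Qed.

Lemma load_halts s : input s -> multiples s -> zeros Aarc s -> zeros Adeg s -> zeros Asum s ->
  halts load_loop s (m.+1 * loop_cost (Assign 2 (Const 0)) (Lt (Reg 2) (Reg 1)) load_body)
    (fun s' => pair_table Aarc s' arc_index /\ degrees (@adj G) s').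
Proof.
move=> ins mul z8 z10 z11.
pose I k s' := exists i, [/\ reg s' 2 = i, k = m - i, pair_table Aarc s' (loaded_arc i)
  & degrees (loaded_edge i) s'].
have L0 u v : loaded_arc 0 u v = 0 by rewrite /loaded_arc; case: arc_to.
have I0 : wp (Assign 2 (Const 0)) (I m) s.
  exists 0; split=> //=; first by rewrite subn0.
    by move=> u v; rewrite L0 z8.
  by split=> u; rewrite ?z10 ?z11 big_pred0 // => v; rewrite /loaded_edge !L0.
apply: halts_mono (halts_loop I0 _) _ _ => // [k s1 f1 [i [r2 -> tab deg]]|s1 f1 [[k [i [r2 _ tab deg]]]]];
  have in1 : input s1 by apply: input_frame f1 ins.
2: {
  rewrite eval_Lt /= r2 (input_m in1) => /eqP; rewrite eqb0 -leqNgt => ge.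
  split=> [u v|]; first by rewrite tab loaded_arcE.
  by apply: degrees_ext deg => u v; rewrite loaded_edgeE.
}
rewrite eval_Lt neq0_bool /eval r2 (input_m in1) => /code_ex[a aE]; rewrite -aE in r2 tab deg *.
have mul1 u : cell s1 Amult (code u) = code u * n.
  by case: f1 => _ -> //; apply: mul; apply: ltnW; apply: code_lt.
apply: (wp_seq (Q1 := fun s' => reg s' 3 = code (arc_tail a))).
  by rewrite /= r2 (input_tail in1).
move=> s2 f2 r3; have [fr2 fc2] := f2.
apply: (wp_seq (Q1 := fun s' => reg s' 4 = code (arc_head a))).
  by rewrite /= fr2 // fc2 // r2 (input_head in1).
move=> s3 f3 r4; have [fr3 fc3] := f3.
have th : arc_tail a != arc_head a by rewrite eq_sym arc_loopless.
have E'E u v : loaded_edge (code a).+1 u v = [|| loaded_edge (code a) u v,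
    (u == arc_tail a) && (v == arc_head a) | (u == arc_head a) && (v == arc_tail a)].
  rewrite /loaded_edge !loaded_arcS [(v == _) && (u == _)]andbC.
  by case: ifP => _; case: ifP => _; rewrite /= ?orbT ?orbF.
(* By simplicity no other arc has these ends, so only the reverse arc can have introduced the edge
   earlier. *)
have new : loaded_arc (code a) (arc_tail a) (arc_head a) = 0.
  by rewrite /loaded_arc (arc_to_head simple) // ltnn.
apply: (wp_seq (Q1 := degrees (loaded_edge (code a).+1))).
  have deg3 : degrees (loaded_edge (code a)) s3.
    by case: deg => d1 d2; split=> u; rewrite fc3 // fc2 // ?d1 ?d2.
  have r33 : reg s3 3 = code (arc_tail a) by rewrite fr3.
  have tab3 : cell s3 Aarc (code (arc_head a) * n + code (arc_tail a)) =
      loaded_arc (code a) (arc_head a) (arc_tail a) by rewrite fc3 // fc2.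
  have mul3 : cell s3 Amult (code (arc_head a)) = code (arc_head a) * n by rewrite fc3 // fc2.
  have ev : eval s3 (IsEq (pair_cell Aarc (Reg 4) (Reg 3)) (Const 0)) =
      (loaded_arc (code a) (arc_head a) (arc_tail a) == 0) by rewrite /= r33 r4 mul3 tab3.
  apply: wp_if; rewrite ev ?neq0_bool.
    move=> /eqP M0.
    have noE : ~~ loaded_edge (code a) (arc_tail a) (arc_head a).
      by rewrite /loaded_edge new M0.
    apply: (add_edge_wp r33 r4 th noE _ E'E deg3).
    by move: noE; rewrite /loaded_edge orbC.
  move/eqP; rewrite eqb0 => M1; apply: degrees_ext deg3 => u v; rewrite E'E.
  case: (boolP (_ && _)) => [/andP[/eqP -> /eqP ->]|_]; first by rewrite /loaded_edge M1 !orbT.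
  case: (boolP (_ && _)) => [/andP[/eqP -> /eqP ->]|_]; first by rewrite /loaded_edge M1 !orbT.
  by rewrite !orbF.
move=> s4 f4 deg4; have [fr4 fc4] := f4.
exists (m - (code a).+1); first by apply: ltn_subS; apply: code_lt.
exists (code a).+1; rewrite /= /set_reg /set_cell /= /upd /=.
have r42 : reg s4 2 = code a by rewrite fr4 // fr3 // fr2.
have r43 : reg s4 3 = code (arc_tail a) by rewrite fr4 // fr3.
have r44 : reg s4 4 = code (arc_head a) by rewrite fr4.
have c7 : cell s4 Amult (code (arc_tail a)) = code (arc_tail a) * n by rewrite fc4 // fc3 // fc2.
rewrite r42 r43 r44 c7 addn1; split=> // u v /=.
rewrite pair_code_eq loaded_arcS; case: ifP => // _.
by rewrite fc4 // fc3 // fc2.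
Qed.

End Load.

End Phases.

(** Follows the rotor orbit of each vertex of [Vr]. The nested traversal is flattened into one loop
    with a loop-free body: registers 2, 3 and 4 hold the vertex, the arc and the slot, and coming
    back to the initial rotor moves on to the next vertex. *)
Definition number_body :=
  If (IsEq (Cell Akind (Reg 2)) (Const 0))
     (Seq (If (IsEq (Reg 4) (Const 0)) (Assign 3 (Minus (Cell Arotor (Reg 2)) (Const 1))) Skip)
     (Seq (Store Aslot (Reg 3) (Reg 4))
     (Seq (Incr 4)
     (Seq (Assign 3 (Cell Atheta (Reg 3)))
          (If (IsEq (Reg 3) (Minus (Cell Arotor (Reg 2)) (Const 1)))
              (Seq (Incr 2) (Assign 4 (Const 0)))
              Skip)))))
     (Incr 2).

Definition number_init := Seq (Assign 2 (Const 0)) (Assign 4 (Const 0)).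

Definition number_loop := Seq number_init (While (Lt (Reg 2) (Reg 0)) number_body).

Section Number.
Variable G : rotor_game.
Implicit Types (u v w : vertex G) (a b : arcs G) (s : state).

Local Notation n := #|vertex G|.
Local Notation m := #|arcs G|.

Definition initial_slot a := slot (Vmax G) (rho0 G) (arc_tail a) true a.

Definition numbered i l : {set arcs G} :=
  [set a | (arc_tail a \in Vr G) && ((code (arc_tail a) < i) ||
     (code (arc_tail a) == i) && (initial_slot a < l))].

Lemma Vr_rotor u : u \in Vr G -> exists2 a, rho0 G u = Some a & rotor_at (Vmax G) (rho0 G) u a.
Proof.
move=> ur; apply: rho0_rotor.
  by rewrite -in_setC -V0_split inE ur.
by rewrite (disjointFr (Vr_Vmax_disjoint G) ur).
Qed.

Lemma vertex_kind0 u : (vertex_kind u == 0) = (u \in Vr G).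
Proof. by rewrite /vertex_kind; case: ifP => //; case: ifP. Qed.

Section CurrentArc.
Variables (u : vertex G) (a0 : arcs G) (l : nat).
Hypothesis rot : rotor_at (Vmax G) (rho0 G) u a0.
Hypothesis lt_l : l < order (@theta G) a0.
Let b := iter l (@theta G) a0.

Lemma current_tail : arc_tail b = u.
Proof.
have [us _ _ t0] := rot.
have : b \in orbit (@theta G) a0 by rewrite -fconnect_orbit fconnect_iter.
by rewrite theta_orbit ?t0 // inE => /eqP.
Qed.

Lemma current_slot : initial_slot b = l.
Proof. by rewrite /initial_slot current_tail (slot_rotor rot) findex_iter. Qed.

Lemma next_current : (theta b == a0) = (l.+1 == order (@theta G) a0).
Proof.
have [us _ _ t0] := rot.
apply/eqP/eqP => [E|E].
  apply/eqP; rewrite eqn_leq lt_l leqNgt; apply/negP => lt.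
  by have := findex_iter lt; rewrite iterS -/b E findex0.
(* Clauses 2 and 4 of [orbitPcycle] are equivalent: since [a0] is reached again from [theta a0],
   iterating [order] times leads back to it. *)
rewrite -[theta b]/(iter l.+1 _ a0) E; apply/(orbitPcycle 2 4).
change (fconnect (@theta G) (theta a0) a0).
by rewrite fconnect_orbit theta_orbit (theta_tail rot) // inE t0.
Qed.

Lemma numberedS a : (a \in numbered (code u) l.+1) =
  (u \in Vr G) && (a == b) || (a \in numbered (code u) l).
Proof.
rewrite !inE; case: (eqVneq a b) => [->|ab].
  by rewrite current_tail current_slot eqxx ltnSn !ltnn; case: (_ \in _).
rewrite andbF /=; case: (arc_tail a \in Vr G) => //=.
rewrite code_eq; case: eqVneq => //= ta; congr (_ || _).
rewrite ltnS leq_eqVlt; case: eqVneq => // sa; case/eqP: ab.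
apply: (slot_inj rot (x := true) (y := true) ta current_tail).
by move: sa; rewrite -{1}current_slot /initial_slot ta current_tail.
Qed.

End CurrentArc.

Lemma numbered_next u a0 : u \in Vr G -> rotor_at (Vmax G) (rho0 G) u a0 ->
  numbered (code u).+1 0 =i numbered (code u) (order (@theta G) a0).
Proof.
move=> ur rot a; rewrite !inE ltn0 andbF orbF ltnS leq_eqVlt orbC.
case: eqVneq => [/code_inj ta|]; last by rewrite !orbF.
by rewrite /initial_slot ta -(period_rotor rot) (slot_lt rot).
Qed.

Lemma numbered_skip u : u \notin Vr G -> numbered (code u).+1 0 =i numbered (code u) 0.
Proof.
move=> ur a; rewrite !inE !ltn0 !andbF !orbF ltnS leq_eqVlt code_eq.
by case: eqVneq => [->|//]; rewrite (negPf ur).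
Qed.

Lemma number_halts s : input G s -> zeros Aslot s ->
  halts number_loop s ((n + m).+1 * loop_cost number_init (Lt (Reg 2) (Reg 0)) number_body)
    (fun s' => forall a, arc_tail a \notin sinks G -> cell s' Aslot (code a) = initial_slot a).
Proof.
move=> ins z.
(* Every round numbers a new arc or passes to the next vertex, so the remaining vertices plus the
   unnumbered arcs decrease. *)
pose I k s' := exists i l, [/\ reg s' 2 = i /\ reg s' 4 = l, i <= n,
  k = (n - i) + (m - #|numbered i l|),
  forall a, cell s' Aslot (code a) = if a \in numbered i l then initial_slot a else 0
  & 0 < l -> exists u a0, [/\ code u = i, u \in Vr G, rotor_at (Vmax G) (rho0 G) u a0,
      l < order (@theta G) a0 & reg s' 3 = code (iter l (@theta G) a0)]].
have N0 a : (a \in numbered 0 0) = false by rewrite !inE !ltn0 !andbF.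
have I0 : wp number_init (I (n + m)) s.
  exists 0, 0; split=> //=; last by move=> a; rewrite N0 z.
  by rewrite subn0; congr (_ + _); rewrite (eq_card0 N0) subn0.
apply: halts_mono (halts_loop I0 _) _ _ => //
  [k s1 f1 [i [l [[r2 r4] lei -> sl cur]]]|s1 f1 [[k [i [l [[r2 r4] lei _ sl cur]]]]]];
  have in1 : input G s1 by apply: input_frame f1 ins.
2: {
  rewrite eval_Lt /= r2 (input_n in1) => /eqP; rewrite eqb0 -leqNgt => ge a ta.
  rewrite sl inE (leq_trans (code_lt _) ge) andbT; case: ifP => // nr.
  (* At an option vertex the cell was never written, and its initial 0 is the slot wanted there. *)
  by rewrite /initial_slot /slot; have [[-> _]|[]] := vertex_cases ta; rewrite // nr.
}
rewrite eval_Lt neq0_bool /eval r2 (input_n in1) => lt; have [u uE] := code_ex lt.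
rewrite -{i}uE in lei lt r2 sl cur *.
have evk : eval s1 (IsEq (Cell Akind (Reg 2)) (Const 0)) = (u \in Vr G).
  by rewrite /= r2 (input_kind in1) vertex_kind0.
apply: wp_if; rewrite evk => /eqP; rewrite ?eqb0 ?eqb1; last first.
  move=> ur; have l0 : l = 0.
    case: (posnP l) => // /cur[v [a0 [/code_inj -> vr]]]; by rewrite vr in ur.
  rewrite l0 in r4 sl cur *.
  exists (n - (code u).+1 + (m - #|numbered (code u).+1 0|)).
    by rewrite (eq_card (numbered_skip ur)) ltn_add2r; apply: ltn_subS.
  exists (code u).+1, 0; rewrite /set_reg /= /upd /= r2 addn1; split=> // a.
  by rewrite numbered_skip.
move=> ur0; have ur : u \in Vr G by case: (u \in Vr G) ur0.
have [a0 E0 rot] := Vr_rotor ur; have [_ _ _ t0] := rot.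
have cur' : 0 < l -> l < order (@theta G) a0 /\ reg s1 3 = code (iter l (@theta G) a0).
  case/cur=> v [a1 [/code_inj -> _ [_ _ E1 _] ll r3]].
  by move: E1; rewrite E0 => -[->].
have lt_l : l < order (@theta G) a0.
  by case: (posnP l) => [->|/cur'[]//]; apply: order_gt0.
pose b := iter l (@theta G) a0.
have rotE : cell s1 Arotor (code u) = (code a0).+1.
  by rewrite (input_rotor in1) /vertex_rotor E0.
apply: (wp_seq (Q1 := fun s' => reg s' 3 = code b)).
  have ev : eval s1 (IsEq (Reg 4) (Const 0)) = (l == 0) by rewrite /= r4.
  apply: wp_if; rewrite ev ?neq0_bool.
    by move=> /eqP l0; rewrite /= /upd /= r2 rotE subn1 /= /b l0.
  by move/eqP; rewrite eqb0 -lt0n => /cur'[_ r3]; rewrite /= r3.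
move=> s2 [fr2 fc2] r3.
have in2 : input G s2 by apply: input_frame (conj fr2 fc2) in1.
have r22 : reg s2 2 = code u by rewrite fr2.
have r24 : reg s2 4 = l by rewrite fr2.
have rotE2 : cell s2 Arotor (code u) = (code a0).+1 by rewrite fc2.
have cE a : cell s2 Aslot (code a) = cell s1 Aslot (code a) by rewrite fc2.
rewrite /= /set_reg /set_cell /= /upd /= r3 r22 r24 rotE2 (input_theta in2) subn1 /=.
rewrite neq0_bool code_eq (next_current rot lt_l).
have nS := numberedS rot lt_l; rewrite ur /= in nS.
have bnew : b \notin numbered (code u) l.
  by rewrite inE (current_tail l rot) ltnn (current_slot rot lt_l) ltnn andbF andbF.
have cardS : #|numbered (code u) l.+1| = #|numbered (code u) l|.+1.
  have -> : numbered (code u) l.+1 = b |: numbered (code u) l by apply/setP => a; rewrite nS !inE.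
  by rewrite cardsU1 bnew.
have lts : m - #|numbered (code u) l.+1| < m - #|numbered (code u) l|.
  by rewrite cardS; apply: ltn_subS; rewrite -cardS; apply: max_card.
have slS a : (if code a == code b then l else cell s2 Aslot (code a)) =
    if a \in numbered (code u) l.+1 then initial_slot a else 0.
  by rewrite code_eq nS cE sl; case: eqVneq => [->|] //=; rewrite (current_slot rot lt_l).
case: eqP => [lE|/eqP lE].
  have nE : numbered (code u).+1 0 =i numbered (code u) l.+1.
    by move=> a; rewrite (numbered_next ur rot) lE.
  exists (n - (code u).+1 + (m - #|numbered (code u).+1 0|)).
    rewrite (eq_card nE) -addnS; apply: leq_add => //; exact: leq_sub2l.
  exists (code u).+1, 0; rewrite addn1; split=> // a.
  by rewrite nE; apply: slS.
exists (n - (code u) + (m - #|numbered (code u) l.+1|)); first by rewrite ltn_add2l.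
exists (code u), l.+1; rewrite addn1; split=> // _.
exists u, a0; split=> //; by rewrite ltn_neqAle lE lt_l.
Qed.

End Number.

(** * Peeling the tree *)

Notation Asrc := 12 (only parsing).
Notation Adst := 13 (only parsing).

(** Register 2 is the scan position and register 3 the vertex under treatment. After a removal the
    latter jumps to the neighbour, possibly ahead of the scan, which then meets that vertex
    again. *)
Definition peel_body :=
  If (IsEq (Cell Adeg (Reg 3)) (Const 1))
     (Seq (Assign 5 (Cell Asum (Reg 3)))
     (Seq (Store Asrc (Reg 10) (Reg 3))
     (Seq (Store Adst (Reg 10) (Reg 5))
     (Seq (Incr 10)
     (Seq (Store Adeg (Reg 3) (Const 0))
     (Seq (Store Asum (Reg 3) (Const 0))
     (Seq (Store Adeg (Reg 5) (Minus (Cell Adeg (Reg 5)) (Const 1)))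
     (Seq (Store Asum (Reg 5) (Minus (Cell Asum (Reg 5)) (Reg 3)))
          (Assign 3 (Reg 5))))))))))
     (Seq (Incr 2) (Assign 3 (Reg 2))).

Definition peel_init := Seq (Assign 2 (Const 0)) (Seq (Assign 3 (Const 0)) (Assign 10 (Const 0))).

(** Repeatedly removes a leaf.  The scan never moves back: removing a leaf can
    only turn its neighbour into a leaf, and this one is treated at once. *)
Definition peel_loop := Seq peel_init (While (Lt (Reg 2) (Reg 0)) peel_body).

Definition in_order (T : Type) (K : seq T -> T -> Prop) (L : seq T) :=
  forall L1 x L2, L = L1 ++ x :: L2 -> K L1 x.

Lemma in_order_rcons (T : Type) (K : seq T -> T -> Prop) L x :
  in_order K L -> K L x -> in_order K (rcons L x).
Proof.
move=> KL Kx L1 y L2; case: (lastP L2) => [|L3 z].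
  by rewrite cats1 => /rcons_inj[<- <-].
by rewrite -rcons_cons -rcons_cat => /rcons_inj[/KL].
Qed.

Definition stored A s (l : seq nat) := forall j, j < size l -> cell s A j = nth 0 l j.

Lemma stored_rcons A s s' l x : stored A s l ->
  (forall j, cell s' A j = if j == size l then x else cell s A j) -> stored A s' (rcons l x).
Proof.
move=> st E j; rewrite size_rcons ltnS nth_rcons E leq_eqVlt; case: eqVneq => [->|_] /=.
  by rewrite ltnn.
by move=> lt; rewrite lt st.
Qed.

Section Peel.
Variable G : rotor_game.
Hypothesis treeG : tree_like G.
Hypothesis simple : simple_digraph G.
Implicit Types (u v w p : vertex G) (a b : arcs G) (s : state).

Local Notation n := #|vertex G|.
Local Notation m := #|arcs G|.

(* Orienting the edges towards a root, an arc is determined by its lower end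
   and by whether it goes up. *)
Lemma card_arcs : m <= 2 * n.
Proof.
case: (pickP (fun _ : arcs G => true)) => [a0 _|no]; last by rewrite eq_card0.
pose u := arc_tail a0.
pose f a := if arc_head a == parent u (arc_tail a) then (arc_tail a, true) else (arc_head a, false).
have low a : arc_head a != parent u (arc_tail a) -> arc_tail a = parent u (arc_head a).
  have ta : adj (arc_tail a) (arc_head a) by apply: adj_head.
  move=> ne; apply: (parentE treeG) => //; apply: contra ne => ub; apply/eqP.
  apply: (parentE treeG); first by rewrite adj_sym.
  apply: (branch_opposite (@adj_sym G) (@adj_irr G)) ub => //.
  by case: treeG => -[].
have inj : injective f.
  move=> a b; rewrite /f; case: ifPn => [/eqP ha|/low ta]; case: ifPn => [/eqP hb|/low tb] //.
    by case=> tt; apply: simple; rewrite ?ha ?hb ?tt.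
  by case=> hh; apply: simple; rewrite ?ta ?tb ?hh.
by rewrite mulnC -card_bool -card_prod -(card_codom inj) max_card.
Qed.

Lemma sum1_eq1 (E : rel (vertex G)) u : \sum_(v | E u v) 1 = 1 -> exists p, forall v, E u v = (v == p).
Proof. by rewrite sum1_card => /mem_card1[p pE]; exists p; move=> v; have := pE v; rewrite !inE. Qed.

(** An edge of [E] pointing into a branch could always be prolonged there, since its far end does
    not have degree 1, but branches shrink strictly. *)
Lemma leafless_empty (E : rel (vertex G)) : symmetric E -> subrel E (@adj G) ->
  (forall v, \sum_(w | E v w) 1 <> 1) -> forall u v, ~~ E u v.
Proof.
move=> symE subE nl u v; apply/negP => uv.
suff : forall p v, adj p v -> ~ E p v by move/(_ u v (subE _ _ uv)).
apply: (branch_ind treeG) => {uv}p {}v pv IH Epv.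
case: (pickP [pred c | E v c & c != p]) => [c /andP[vc cp]|no].
  exact: (IH c (subE _ _ vc) cp vc).
case: (nl v); rewrite sum1_card (@eq_card1 _ p) // => c.
rewrite -[LHS]/(E v c) -[RHS]/(c == p); have := no c => /=.
by case: eqVneq => [->|_]; rewrite ?andbT // symE Epv.
Qed.

(** A message from [v] to [p] may be sent when all the other neighbours of [v]
    have sent theirs to [v]. *)
Definition sendable (L : seq (vertex G * vertex G)) (x : vertex G * vertex G) :=
  [/\ adj x.1 x.2, forall w, adj x.1 w -> w != x.2 -> (w, x.1) \in L & x \notin L].

Record peeled s (L : seq (vertex G * vertex G)) : Prop := Peeled {
  peeled_size : reg s 10 = size L;
  peeled_src : stored Asrc s [seq code x.1 | x <- L];
  peeled_dst : stored Adst s [seq code x.2 | x <- L];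
  peeled_order : in_order sendable L;
  peeled_uniq : uniq (unzip1 L);
  peeled_anti : forall u v, (u, v) \in L -> (v, u) \notin L }.

Lemma peeled_card s L : peeled s L -> size L <= n.
Proof.
by move=> pl; rewrite -(size_map fst L) -(card_uniqP (peeled_uniq pl)) max_card.
Qed.

Record peeling s (E : rel (vertex G)) (L : seq (vertex G * vertex G)) : Prop := Peeling {
  peeling_sym : symmetric E;
  peeling_adj : forall u v, adj u v = [|| E u v, (u, v) \in L | (v, u) \in L];
  peeling_done : forall u v, (u, v) \in L -> forall w, ~~ E u w;
  peeling_degrees : degrees E s }.

(** The last clause, that no vertex but [p] can have become a leaf, is what allows the scan never to
    look back. *)
Lemma peel_step s E L u : peeled s L -> peeling s E L -> reg s 3 = code u ->
  cell s Adeg (code u) = 1 ->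
  wp peel_body (fun s' => exists p E', [/\ peeled s' (rcons L (u, p)), peeling s' E' (rcons L (u, p)),
    reg s' 3 = code p, reg s' 2 = reg s 2 &
    forall v, v != p -> \sum_(w | E' v w) 1 = 1 -> v != u /\ \sum_(w | E v w) 1 = 1]) s.
Proof.
move=> pl [symE adjE doneE [deg sum]] r3 du.
have [p pE] : exists p, forall v, E u v = (v == p) by apply: sum1_eq1; rewrite -deg.
have su : cell s Asum (code u) = code p.
  by rewrite sum (eq_bigl (pred1 p)) ?big_pred1_eq // => v; rewrite pE.
have Eup : E u p by rewrite pE eqxx.
have aup : adj u p by rewrite adjE Eup.
have up : u != p by apply: contraTneq aup => ->; rewrite adj_irr.
have nu v : (u, v) \notin L by apply/negP => /doneE/(_ p); rewrite Eup.
have np v : (p, v) \notin L by apply/negP => /doneE/(_ u); rewrite symE Eup.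
pose E' : rel (vertex G) := fun x y => E x y && ~~ ((x == u) && (y == p) || (x == p) && (y == u)).
have EE' x y : E x y = [|| E' x y, (x == u) && (y == p) | (x == p) && (y == u)].
  rewrite /E'; case: (boolP ((x == u) && (y == p))) => [/andP[/eqP -> /eqP ->]|_]; first by rewrite Eup !orbT.
  case: (boolP ((x == p) && (y == u))) => [/andP[/eqP -> /eqP ->]|_]; first by rewrite symE Eup !orbT.
  by rewrite andbT !orbF.
have nE1 : ~~ E' u p by rewrite /E' !eqxx andbF.
have nE2 : ~~ E' p u by rewrite /E' !eqxx orbT andbF.
have sumE := sum_add_edge _ up nE1 nE2 EE'.
rewrite /peel_body; apply: wp_if; last by rewrite /= r3 du.
move=> _; rewrite /= /set_reg /set_cell /= /upd /= r3 su (peeled_size pl).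
exists p, E'; split=> //.
- split=> /=; rewrite ?size_rcons ?addn1 ?map_rcons //.
  + by apply: stored_rcons (peeled_src pl) _ => j; rewrite size_map.
  + by apply: stored_rcons (peeled_dst pl) _ => j; rewrite size_map.
  (* The edge to any other neighbour [w] has left [E], and not by a removal of [u], which still has
     an edge; so [w] was the sender. *)
  + apply: in_order_rcons (peeled_order pl) _; split=> //= w uw wp.
    by move: uw; rewrite adjE pE (negPf wp) (negPf (nu w)).
  + rewrite /unzip1 map_rcons rcons_uniq (peeled_uniq pl) andbT /=.
    by apply/mapP => -[[x y] xy /= ux]; have := nu y; rewrite ux xy.
  + move=> x y; rewrite !mem_rcons !inE !xpair_eqE.
    case/orP => [/andP[/eqP -> /eqP ->]|xy].
      by rewrite (negPf up) andbF (negPf (np u)).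
    rewrite (negPf (peeled_anti pl xy)) orbF; apply/negP => /andP[/eqP yu /eqP xp].
    by have := np y; rewrite -xp xy.
- split.
  + by move=> x y; rewrite /E' symE [(x == u) && _]andbC [(x == p) && _]andbC orbC.
  + move=> x y; rewrite adjE EE' !mem_rcons !inE !xpair_eqE.
    rewrite [(y == u) && (x == p)]andbC.
    by case: (E' x y); case: ((x == u) && (y == p)); case: ((x == p) && (y == u)); rewrite ?orbT.
  + move=> x y; rewrite mem_rcons inE xpair_eqE => /orP[/andP[/eqP -> _]|/doneE xw] w.
      by rewrite /E' pE; case: eqVneq => // ->; rewrite eqxx.
    by rewrite /E' (negPf (xw w)).
  + split=> x /=; rewrite !code_eq.
    * case: (eqVneq x p) => [->|xp].
        by rewrite eq_sym (negPf up) deg sumE eq_sym (negPf up) eqxx mul0n mul1n addnK.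
      case: (eqVneq x u) => [->|xu]; last by rewrite deg sumE (negPf xp) (negPf xu) addn0.
      by move: du; rewrite deg sumE eqxx (negPf up) mul1n mul0n addn0 addn1 => -[].
    * case: (eqVneq x p) => [->|xp].
        by rewrite eq_sym (negPf up) sum sumE eq_sym (negPf up) eqxx mul0n mul1n addnK.
      case: (eqVneq x u) => [->|xu]; last by rewrite sum sumE (negPf xp) (negPf xu) addn0.
      move/eqP: su; rewrite sum sumE eqxx (negPf up) mul1n mul0n addn0.
      by rewrite -{2}[code p]add0n eqn_add2r => /eqP.
- move=> v vp; rewrite (sumE (fun=> 1) v) (negPf vp).
  case: (eqVneq v u) => [->|_] s1; last by rewrite ?s1.
  by move: du; rewrite deg (sumE (fun=> 1) u) eqxx (negPf up) s1.
Qed.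

Lemma peel_halts s : input G s -> degrees (@adj G) s ->
  halts peel_loop s ((n + n).+1 * loop_cost peel_init (Lt (Reg 2) (Reg 0)) peel_body)
    (fun s' => exists L, peeled s' L /\ forall u v, adj u v -> (u, v) \in L \/ (v, u) \in L).
Proof.
move=> ins deg.
(* Key invariant: a leaf at or before the scan position can only be the vertex under treatment. When
   the scan ends register 3 holds [n], which numbers no vertex, so no leaf is left and hence no
   edge. *)
pose I k s' := exists i E L, [/\ reg s' 2 = i, i <= n /\ k = (n - i) + (n - size L),
  peeled s' L, peeling s' E L &
  [/\ (i < n -> exists w, reg s' 3 = code w), (i = n -> reg s' 3 = n) &
   forall v, code v <= i -> \sum_(w | E v w) 1 = 1 -> reg s' 3 = code v]].
have I0 : wp peel_init (I (n + n)) s.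
  exists 0, (@adj G), [::]; rewrite /= /set_reg /= /upd /=; split=> //.
  - by rewrite !subn0.
  - by split=> //; case.
  - by split=> //= [|u v]; [apply: adj_sym | rewrite orbF].
  - split=> // [|v]; first by move/code_ex => [w <-]; exists w.
    by rewrite leqn0 => /eqP ->.
apply: halts_mono (halts_loop I0 _) _ _ => //
  [k s1 f1 [i [E [L [r2 [lei ->] pl pg [cw cn leaf]]]]]|s1 f1 [[k [i [E [L [r2 [lei _] pl pg [cw cn leaf]]]]]]]];
  have in1 : input G s1 by apply: input_frame f1 ins.
2: {
  rewrite eval_Lt /= r2 (input_n in1) => /eqP; rewrite eqb0 -leqNgt => ge.
  have iE : i = n by apply/eqP; rewrite eqn_leq lei.
  exists L; split=> // u v; rewrite (peeling_adj pg).
  have noE : forall u v, ~~ E u v.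
    apply: leafless_empty; first exact: peeling_sym pg.
      by move=> x y xy; rewrite (peeling_adj pg) xy.
    move=> w; move/(leaf w); rewrite cn // iE => /(_ (ltnW (code_lt w))) E1.
    by have := code_lt w; rewrite -E1 ltnn.
  by rewrite (negPf (noE u v)) /= => /orP.
}
rewrite eval_Lt neq0_bool /eval r2 (input_n in1) => lt; have [w r3] := cw lt.
case: (eqVneq (cell s1 Adeg (code w)) 1) => [d1|d1].
  apply: wp_mono (peel_step pl pg r3 d1) => s2 [p [E' [pl2 pg2 r32 r22 leaf2]]].
  have ls := peeled_card pl2; rewrite size_rcons in ls.
  exists (n - i + (n - size (rcons L (w, p)))); first by rewrite size_rcons ltn_add2l ltn_subS.
  exists i, E', (rcons L (w, p)); split=> //; first by rewrite r22.
  split=> [_|iE|v lev]; first by exists p.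
    by move: lt; rewrite iE ltnn.
  case: (eqVneq v p) => [->//|vp] /(leaf2 _ vp)[vw] /(leaf _ lev); rewrite r3 => /code_inj wv.
  by rewrite wv eqxx in vw.
rewrite /peel_body; apply: wp_if; rewrite /eval r3 ?neq0_bool; first by rewrite (negPf d1).
move=> _; exists (n - i.+1 + (n - size L)); first by rewrite ltn_add2r ltn_subS.
exists i.+1, E, L; rewrite /= /set_reg /= /upd /= r2 addn1; split=> //.
- by case: pl.
- by case: pg.
- split=> // [|v]; first by move/code_ex => [v <-]; exists v.
  rewrite leq_eqVlt ltnS => /orP[/eqP ->//|lev] s1v.
  have := leaf _ lev s1v; rewrite r3 => /code_inj wv.
  by move: d1; case: pg => _ _ _ [deg1 _]; rewrite deg1 wv s1v.
Qed.

End Peel.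

(** * Exchange of messages *)

Definition swap (T : Type) (x : T * T) := (x.2, x.1).

Section Schedule.
Variable G : rotor_game.
Implicit Types (u v w : vertex G) (L : seq (vertex G * vertex G)).

Definition schedule L := L ++ rev (map (@swap _) L).

(* A neighbour [w] of [v] other than [u] sends to [v] either in the first half or,
   if [(v, w)] comes after [(u, v)] in [L], in the second half before [u] receives. *)
Lemma schedule_order L : in_order (@sendable G) L -> uniq L ->
  (forall u v, (u, v) \in L -> (v, u) \notin L) ->
  (forall u v, adj u v -> (u, v) \in L \/ (v, u) \in L) ->
  in_order (@sendable G) (schedule L).
Proof.
move=> ordL uL anti full.
suff H L2 : forall L1, L = L1 ++ L2 -> in_order (@sendable G) (L ++ rev (map (@swap _) L2)) by apply: (H L [::]).
elim: L2 => [|[u v] L2 IH] L1 LE; first by rewrite cats0.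
rewrite map_cons rev_cons -rcons_cat; apply: in_order_rcons.
  by apply: (IH (rcons L1 (u, v))); rewrite cat_rcons.
have [/= uv _ nin] := ordL _ _ _ LE.
have uvL : (u, v) \in L by rewrite LE mem_cat inE eqxx orbT.
have swapE x l : (x \in map (@swap _) l) = (swap x \in l).
  by case: x => x y; apply/mapP/idP => [[[x' y'] xl [-> ->]]|xl] //; exists (y, x).
split=> /= [|w vw wu|]; first by rewrite adj_sym.
  rewrite mem_cat mem_rev swapE /swap /=.
  case: (full _ _ vw) => [vwL|->] //; rewrite LE mem_cat inE in vwL.
  case/or3P: vwL => [vwL1|/eqP[vu _]|->]; last by rewrite orbT.
    case/splitPr: vwL1 LE nin => M1 M2; rewrite -catA /= => LE.
    have [/= _ /(_ u) M1u _] := ordL _ _ _ LE.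
    rewrite mem_cat negb_or M1u //; first by rewrite adj_sym.
    by rewrite eq_sym.
  by move: uv; rewrite vu adj_irr.
rewrite mem_cat mem_rev swapE /swap /= negb_or anti //=.
by move: uL; rewrite LE cat_uniq /= => /and3P[_ _ /andP[]].
Qed.

Lemma schedule_full L : (forall u v, adj u v -> (u, v) \in L \/ (v, u) \in L) ->
  forall u v, adj u v -> (u, v) \in schedule L.
Proof.
move=> full u v uv; rewrite mem_cat mem_rev; case: (full _ _ uv) => [->//|vu].
by apply/orP; right; apply/mapP; exists (v, u).
Qed.

End Schedule.

(** * The two earliest events *)

Section TopTwo.
Variable (T : eqType) (hit : T -> nat).
Implicit Types (P : pred T) (o : option T).

(** A relation and not a function, because events of an option vertex may tie; any of the earliest
    is then acceptable. *)
Definition first_of P o :=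
  if o is Some b then P b /\ forall c, P c -> hit b <= hit c else forall c, ~~ P c.

Definition top2 P o1 o2 := first_of P o1 /\ first_of [pred c | P c && (Some c != o1)] o2.

Definition before a o := if o is Some b then hit a < hit b else true.

Lemma eq_first_of P P' o : P =1 P' -> first_of P o -> first_of P' o.
Proof.
move=> PP; case: o => [b|] /= => [[Pb le]|no c]; last by rewrite -PP.
by split=> [|c]; rewrite -PP //; apply: le.
Qed.

Lemma eq_top2 P P' o1 o2 : P =1 P' -> top2 P o1 o2 -> top2 P' o1 o2.
Proof.
move=> PP [t1 t2]; split; first exact: eq_first_of t1.
by apply: eq_first_of t2 => c /=; rewrite PP.
Qed.

Lemma top2_insert P P' a o1 o2 : top2 P o1 o2 -> ~~ P a -> (forall c, P' c = (c == a) || P c) ->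
  top2 P' (if before a o1 then Some a else o1)
          (if before a o1 then o1 else if before a o2 then Some a else o2).
Proof.
move=> [t1 t2] nPa P'E; case: ifP => b1.
  split=> /=.
    rewrite P'E eqxx; split=> // c; rewrite P'E => /orP[/eqP -> //|Pc].
    case: o1 t1 b1 {t2} => [b|] /= => [[_ le] lt|/(_ c)]; last by rewrite Pc.
    exact: leq_trans (ltnW lt) (le _ Pc).
  apply: eq_first_of t1 => c /=; rewrite P'E.
  rewrite -[Some c == Some a]/(c == a).
  by case: eqVneq => [->|]; rewrite ?andbT // (negPf nPa).
case: o1 t1 t2 b1 => [b|] //= [Pb le1] t2 b1.
have ba : b != a by apply: contraNneq nPa => <-.
split.
  split=> [|c]; first by rewrite P'E Pb orbT.
  rewrite P'E => /orP[/eqP ->|/le1 //]; by rewrite leqNgt b1.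
case: ifP => b2.
  split=> /=; first by rewrite P'E eqxx /=; rewrite -[_ == _]/(a == b) eq_sym ba.
  move=> c; rewrite P'E => /andP[/orP[/eqP -> //|Pc] cb].
  case: o2 t2 b2 => [d|] /= => [[_ le2] lt|/(_ c)]; last by rewrite Pc cb.
  by apply: leq_trans (ltnW lt) (le2 _ _); rewrite Pc.
case: o2 t2 b2 => [d|] //= [/andP[Pd db] le2] b2; split=> [|c].
  by rewrite P'E Pd orbT.
rewrite P'E => /andP[/orP[/eqP -> _|Pc cb]]; first by rewrite leqNgt b2.
by apply: le2; rewrite Pc.
Qed.

(** Why two events suffice: excluding one neighbour excludes at most one event, and if it is the
    earliest, the second one is the earliest of the rest. *)
Lemma top2_except P P' (q : pred T) o1 o2 : top2 P o1 o2 ->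
  (forall c d, P c -> P d -> q c -> q d -> c = d) ->
  (forall c, P' c = P c && ~~ q c) ->
  first_of P' (if o1 is Some b then if q b then o2 else o1 else o1).
Proof.
move=> [t1 t2] inj P'E; case: o1 t1 t2 => [b|] /= => [[Pb le1] t2|no _ c]; last by rewrite P'E (negPf (no c)).
case: ifPn => qb.
  apply: eq_first_of t2 => c /=; rewrite P'E -[Some c == Some b]/(c == b).
  case Pc: (P c) => //=; congr negb; apply/eqP/idP => [->//|qc].
  exact: inj.
by split=> [|c]; rewrite P'E ?Pb // => /andP[/le1].
Qed.

End TopTwo.

Section Messages.
Variable G : rotor_game.
Hypothesis treeG : tree_like G.
Hypothesis simple : simple_digraph G.
Implicit Types (p u v w : vertex G) (a b c : arcs G).

Definition best_hit v := hit (Vmax G) (rho0 G) v (best_outcome v).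
Definition best_slot v x c := slot (Vmax G) (rho0 G) v x c.

Lemma best_slot_lt v x c : v \notin sinks G -> arc_tail c = v ->
  best_slot v x c < period (Vmax G) (rho0 G) v.
Proof.
move=> vs tc; case: (rho0_ruled vs) => [vm|[a rot]]; last exact: (slot_lt rot x tc).
by rewrite /best_slot /slot /period vm; case: x.
Qed.

(** Slots stay below the period, so a time is a number in base k with last digit the slot; comparing
    the digits avoids the product. *)
Lemma best_hit_lt v b c r x r' x' : v \notin sinks G -> arc_tail b = v -> arc_tail c = v ->
  best_outcome v (arc_head b) = Some (r, x) -> best_outcome v (arc_head c) = Some (r', x') ->
  (best_hit v b < best_hit v c) = (r < r') || (r == r') && (best_slot v x b < best_slot v x' c).
Proof.
move=> vs tb tc fb fc; rewrite /best_hit /hit fb fc.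
have := best_slot_lt x vs tb; have := best_slot_lt x' vs tc; rewrite /best_slot.
move: (slot _ _ _ x' c) (slot _ _ _ x b) (period _ _ _) => s' s k; clear => ls' ls.
case: (ltngtP r r') => [lt|lt|->] /=.
- apply: leq_trans (_ : r.+1 * k <= _); first by rewrite mulSn addnC ltn_add2r.
  by apply: leq_trans (leq_addr _ _); rewrite leq_mul2r lt orbT.
- apply/negbTE; rewrite -leqNgt; apply: leq_trans (_ : r'.+1 * k <= _).
    by rewrite mulSn addnC leq_add2r ltnW.
  by apply: leq_trans (leq_addr _ _); rewrite leq_mul2r lt orbT.
- by rewrite ltn_add2l.
Qed.

Lemma returns_lex p v b r x : v \notin sinks G -> arc_tail b = v ->
  best_outcome v (arc_head b) = Some (r, x) ->
  returns (Vmax G) (rho0 G) v p (best_hit v b) =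
  if arc_to v p is Some c then r + (initial_slot c < best_slot v x b) else 0.
Proof.
move=> vs tb fb; rewrite /returns /best_hit /hit fb; case E: (arc_to v p) => [c|] //.
have [tc _] := arc_toP E; rewrite /initial_slot tc.
have := best_slot_lt x vs tb; have := best_slot_lt true vs tc; rewrite /best_slot.
move: (slot _ _ _ x b) (slot _ _ _ true c) (period _ _ _) => s s' k; clear => ls' ls.
have k0 : 0 < k by apply: leq_ltn_trans ls.
rewrite -addnA divnMDl //; congr (_ + _); case: ltnP => lt.
  have -> : s + (k.-1 - s') = (s - s'.+1) + k by move: lt ls; clear -k0 ls'; lia.
  by rewrite divnDr // divnn k0 divn_small //; move: ls; clear; lia.
by rewrite divn_small //; move: lt ls' k0; clear; lia.
Qed.

Definition received v (S : seq (vertex G * vertex G)) : pred (arcs G) :=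
  [pred c | [&& arc_tail c == v, (arc_head c, v) \in S & isSome (best_outcome v (arc_head c))]].

Lemma node_first_of p v o : v \notin sinks G ->
  first_of (best_hit v) (event p v (best_outcome v)) o ->
  node (@win G) (Vmax G) (rho0 G) p v (best_outcome v) =
  if o is Some b then
    if best_outcome v (arc_head b) is Some (r, x)
    then Some (if arc_to v p is Some c then r + (initial_slot c < best_slot v x b) else 0, x) else None
  else None.
Proof.
move=> vs; case: o => [b|] /=; last exact: node_no_event.
case=> eb le; have [/eqP tb _ fb] := and3P eb; case E: (best_outcome v _) fb => [[r x]|] // _.
have fst : first_event (Vmax G) (rho0 G) p v (best_outcome v) b.
  by rewrite /first_event eb; apply/forallP => c; apply/implyP => /le.
by rewrite (node_first _ vs (rho0_ruled vs) fst E) -/(best_hit v b) (returns_lex _ vs tb E).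
Qed.

Lemma received_head_inj v S c d : c \in received v S -> d \in received v S ->
  arc_head c = arc_head d -> c = d.
Proof.
by move=> /and3P[/eqP tc _ _] /and3P[/eqP td _ _]; apply: simple; rewrite tc td.
Qed.

Definition candidate p o1 o2 : option (arcs G) :=
  if o1 is Some b then if arc_head b == p then o2 else o1 else o1.

(** In the second half of the schedule the message of [p] itself may already have come in;
    [candidate] discards it, while [sendable] ensures that those of all other neighbours have
    arrived. *)
Lemma message_outcome p v S o1 o2 : v \notin sinks G -> sendable S (v, p) ->
  top2 (best_hit v) (received v S) o1 o2 ->
  best_outcome p v =
  if candidate p o1 o2 is Some b then
    if best_outcome v (arc_head b) is Some (r, x)
    then Some (if arc_to v p is Some c then r + (initial_slot c < best_slot v x b) else 0, x) else None
  else None.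
Proof.
move=> vs [/= vp sent _] t2; rewrite /best_outcome (branch_outcomeE treeG); last by rewrite adj_sym.
apply: node_first_of => //.
apply: (top2_except (q := fun c => arc_head c == p) t2) => [c d Pc Pd /eqP hc /eqP hd|c].
  by apply: received_head_inj Pc Pd _; rewrite hc hd.
rewrite /event /received /=; case: eqP => //= tc; case: eqVneq => [hc|hc]; first by rewrite andbF.
by rewrite sent ?andbT // adj_head.
Qed.

Lemma sink_outcome p v : adj p v -> v \in sinks G -> best_outcome p v = Some (0, win v).
Proof. by move=> pv vs; rewrite /best_outcome (branch_outcomeE treeG) // /node vs. Qed.

Lemma received_other v S (a b : vertex G) : v != b -> received v (rcons S (a, b)) =1 received v S.
Proof. by move=> vb c; rewrite /received /= mem_rcons inE xpair_eqE (negPf vb) andbF. Qed.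

Lemma received_useless S (a b : vertex G) : (if arc_to b a is Some _ then best_outcome b a = None else True) ->
  received b (rcons S (a, b)) =1 received b S.
Proof.
move=> E c; rewrite /received /= mem_rcons inE xpair_eqE eqxx andbT.
case: eqP => //= tc; case: eqVneq => //= hc.
by move: E; rewrite -tc (arc_to_head simple hc) tc hc => ->; rewrite andbF.
Qed.

Lemma received_new S (a b : vertex G) c : arc_to b a = Some c -> best_outcome b a <> None ->
  forall d, received b (rcons S (a, b)) d = (d == c) || received b S d.
Proof.
move=> /arc_toP[tc hc] nN d; rewrite /received /= mem_rcons inE xpair_eqE eqxx andbT.
case: (eqVneq d c) => [->|dc]; first by rewrite tc hc !eqxx; case: best_outcome nN.
case: eqP => //= td; case: eqVneq => //= hd; case/eqP: dc.
by apply: simple; rewrite ?tc ?hc.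
Qed.

Lemma received_notin S (a b : vertex G) c : arc_to b a = Some c -> (a, b) \notin S -> ~~ received b S c.
Proof. by move=> /arc_toP[_ hc] ab; rewrite /received /= hc (negPf ab) andbF. Qed.

End Messages.

(* The two earliest events received so far at each vertex; each is stored in
   four consecutive arrays as the successor of its neighbour's number (0 if
   there is no event), returns, slot and value. *)
Notation Afirst := 14 (only parsing).
Notation Asecond := 18 (only parsing).

Definition load_entry (A : nat) :=
  Seq (Assign 5 (Cell A (Reg 3)))
 (Seq (Assign 6 (Cell A.+1 (Reg 3)))
 (Seq (Assign 7 (Cell A.+2 (Reg 3)))
      (Assign 8 (Cell A.+3 (Reg 3))))).

(* Computes the message from the vertex in register 3 to the one in register 4. *)
Definition compute_message :=
  If (IsEq (Cell Akind (Reg 3)) (Const 2))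
     (Seq (Assign 5 (Const 1)) (Seq (Assign 6 (Const 0)) (Assign 8 (Cell Avalue (Reg 3)))))
     (Seq (If (IsEq (Cell Afirst (Reg 3)) (Plus (Reg 4) (Const 1)))
              (load_entry Asecond) (load_entry Afirst))
     (Seq (Assign 9 (pair_cell Aarc (Reg 3) (Reg 4)))
          (If (IsEq (Reg 9) (Const 0))
              (Assign 6 (Const 0))
              (Assign 6 (Plus (Reg 6) (Lt (Cell Aslot (Minus (Reg 9) (Const 1))) (Reg 7))))))).

(* Holds if entry [A] is absent or later than the pair in registers 6 and 7. *)
Definition precedes (A : nat) :=
  Plus (IsEq (Cell A (Reg 4)) (Const 0))
 (Plus (Lt (Reg 6) (Cell A.+1 (Reg 4)))
       (Lt (Const 1) (Plus (IsEq (Reg 6) (Cell A.+1 (Reg 4)))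
                           (Lt (Reg 7) (Cell A.+2 (Reg 4)))))).

Definition store_entry (A : nat) :=
  Seq (Store A (Reg 4) (Plus (Reg 3) (Const 1)))
 (Seq (Store A.+1 (Reg 4) (Reg 6))
 (Seq (Store A.+2 (Reg 4) (Reg 7))
      (Store A.+3 (Reg 4) (Reg 8)))).

Definition shift_entries :=
  Seq (Store Asecond (Reg 4) (Cell Afirst (Reg 4)))
 (Seq (Store Asecond.+1 (Reg 4) (Cell Afirst.+1 (Reg 4)))
 (Seq (Store Asecond.+2 (Reg 4) (Cell Afirst.+2 (Reg 4)))
      (Store Asecond.+3 (Reg 4) (Cell Afirst.+3 (Reg 4))))).

Definition insert_entry :=
  If (precedes Afirst) (Seq shift_entries (store_entry Afirst))
     (If (precedes Asecond) (store_entry Asecond) Skip).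

(** Registers 5, 6 and 8 carry the message, whereas the slot in register 7 is relative to a vertex
    and is recomputed for the receiver. Nothing is inserted at a sink, for a branch that never
    absorbs, or without an arc towards the sender. *)
Definition insert_message :=
  Seq (Assign 9 (pair_cell Aarc (Reg 4) (Reg 3)))
      (If (IsEq (Cell Akind (Reg 4)) (Const 2)) Skip
      (If (IsEq (Reg 5) (Const 0)) Skip
      (If (IsEq (Reg 9) (Const 0)) Skip
     (Seq (If (IsEq (Cell Akind (Reg 4)) (Const 0))
              (Assign 7 (Cell Aslot (Minus (Reg 9) (Const 1))))
              (Assign 7 (Minus (Const 1) (Reg 8))))
          insert_entry)))).

Section Exchange.
Variable G : rotor_game.
Hypothesis treeG : tree_like G.
Hypothesis simple : simple_digraph G.
Hypothesis binary : binary_values G.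
Implicit Types (u v w p : vertex G) (a b c : arcs G) (s : state).

Local Notation n := #|vertex G|.

Record tables s : Prop := Tables {
  tables_input : input G s;
  tables_mult : multiples G s;
  tables_arc : pair_table Aarc s (@arc_index G);
  tables_slot : forall a, arc_tail a \notin sinks G -> cell s Aslot (code a) = initial_slot a }.

Lemma tables_frame (c : cmd) s s' : all (fun r => r \notin wregs c) [:: 0; 1] ->
  all (fun A => A \notin warrs c) (iota 0 6 ++ [:: Amult; Aarc; Aslot]) ->
  frame c s s' -> tables s -> tables s'.
Proof.
move=> rs; rewrite all_cat => /andP[as6 /and4P[a7 a8 a9 _]] f [i0 m0 p0 s0]; have [_ fc] := f.
split; first exact: input_frame f i0.
- by move=> j le; rewrite fc // m0.
- by move=> u v; rewrite fc // p0.
- by move=> a ta; rewrite fc // s0.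
Qed.

Definition entry (A : nat) s v (o : option (arcs G)) : Prop :=
  if o is Some b then exists r x, [/\ best_outcome v (arc_head b) = Some (r, x),
    cell s A (code v) = (code (arc_head b)).+1, cell s A.+1 (code v) = r,
    cell s A.+2 (code v) = best_slot v x b & cell s A.+3 (code v) = x]
  else cell s A (code v) = 0.

Lemma entry_same A s s' v o : (forall i, i < 4 -> cell s' (A + i) (code v) = cell s (A + i) (code v)) ->
  entry A s v o -> entry A s' v o.
Proof.
move=> E; have := (E 0 isT, E 1 isT, E 2 isT, E 3 isT).
by rewrite addn0 addn1 addn2 addn3 /entry => -[[[-> ->] ->] ->].
Qed.

Definition tops (S : seq (vertex G * vertex G)) s := forall v, v \notin sinks G ->
  exists o1 o2, [/\ top2 (best_hit v) (received v S) o1 o2, entry Afirst s v o1 & entry Asecond s v o2].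

Definition message s (o : outcome) : Prop :=
  if o is Some (r, x) then [/\ reg s 5 != 0, reg s 6 = r & reg s 8 = x :> nat] else reg s 5 = 0.

Lemma vertex_kind2 v : (vertex_kind v == 2) = (v \in sinks G).
Proof.
rewrite /vertex_kind; case: (boolP (v \in sinks G)) => vs.
  have : v \notin Vr G :|: Vmax G by rewrite V0_split inE vs.
  by rewrite inE negb_or => /andP[/negPf -> /negPf ->].
by have [[vm vr]|[vr vm]] := vertex_cases vs; rewrite ?vr ?(negPf vr) ?vm.
Qed.

Lemma load_entry_wp A s v o : reg s 3 = code v -> entry A s v o ->
  wp (load_entry A) (fun s' => if o is Some b
    then exists r x, [/\ best_outcome v (arc_head b) = Some (r, x), reg s' 5 != 0, reg s' 6 = r,
                         reg s' 7 = best_slot v x b & reg s' 8 = x :> nat]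
    else reg s' 5 = 0) s.
Proof.
rewrite /= /set_reg /= /upd /= => ->; case: o => [b [r [x [E -> -> -> ->]]]|//].
by exists r, x.
Qed.

Lemma compute_message_wp S s v p : tables s -> tops S s -> sendable S (v, p) ->
  reg s 3 = code v -> reg s 4 = code p ->
  wp compute_message (fun s' => message s' (best_outcome p v)) s.
Proof.
move=> tb tp sd r3 r4; have [vp _ _] := sd; rewrite [_.1]/= [_.2]/= in vp; have ins := tables_input tb.
have ev : eval s (IsEq (Cell Akind (Reg 3)) (Const 2)) = (v \in sinks G).
  by rewrite /= r3 (input_kind ins) vertex_kind2.
apply: wp_if; rewrite ev ?neq0_bool.
  move=> vs; rewrite sink_outcome //; last by rewrite adj_sym.
  rewrite /= /set_reg /= /upd /= r3; split=> //.
  by rewrite (input_value ins) /vertex_value vs sink_value.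
move/eqP; rewrite eqb0 => vs; have [o1 [o2 [t2 e1 e2]]] := tp v vs.
have mE := message_outcome treeG simple vs sd t2.
pose Q s' := if candidate p o1 o2 is Some b
    then exists r x, [/\ best_outcome v (arc_head b) = Some (r, x), reg s' 5 != 0, reg s' 6 = r,
                         reg s' 7 = best_slot v x b & reg s' 8 = x :> nat]
    else reg s' 5 = 0.
apply: (wp_seq (Q1 := Q)).
  (* Entries hold the number of the neighbour plus one, so an absent entry, 0, never matches [p]. *)
  apply: wp_if; rewrite /eval r3 r4 addn1 ?neq0_bool.
    move/eqP => E; rewrite /Q; case: o1 e1 t2 {mE Q} E => [b|] /=; last by move=> ->.
    case=> [r [x [_ -> _ _ _]]] _ [/code_inj ->]; rewrite eqxx.
    exact: load_entry_wp.
  move/eqP; rewrite eqb0 => E; rewrite /Q.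
  have -> : candidate p o1 o2 = o1.
    case: o1 e1 {t2 mE Q} E => [b|] //= [r [x [_ -> _ _ _]]].
    by rewrite eqSS code_eq => /negPf ->.
  exact: load_entry_wp.
move=> s2 f2 Q2; have [fr2 fc2] := f2.
apply: (wp_seq (Q1 := fun s' => reg s' 9 = arc_index v p)).
  rewrite /= !fr2 // !fc2 // r3 r4 (tables_mult tb) ?(tables_arc tb) //.
  by apply: ltnW; apply: code_lt.
move=> s3 f3 r9; have [fr3 fc3] := f3.
have slE c : arc_to v p = Some c -> cell s3 Aslot (code c) = initial_slot c.
  by case/arc_toP => tc _; rewrite fc3 // fc2 // (tables_slot tb) // tc.
move: Q2; rewrite /Q mE; case: (candidate p o1 o2) => [b [r [x [E r5 r6 r7 r8]]]|r5]; last first.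
  by rewrite /message /= /set_reg /= /upd /=; case: ifP => _; rewrite fr3.
rewrite E; move: r9; rewrite /arc_index; case Eto: (arc_to v p) => [c|] r9.
  rewrite /message /= r9 /= /set_reg /= /upd /= subn1 /= slE // !fr3 // r6 r7 addn1.
  by split.
by rewrite /message /= r9 /= /set_reg /= /upd /= !fr3.
Qed.

(** The test encodes connectives arithmetically: a disjunction is a nonzero sum, a conjunction a sum
    of two truth values exceeding 1. *)
Lemma precedesE A s p o c r x : p \notin sinks G -> reg s 4 = code p -> entry A s p o ->
  arc_tail c = p -> (forall b, o = Some b -> arc_tail b = p) ->
  best_outcome p (arc_head c) = Some (r, x) -> reg s 6 = r -> reg s 7 = best_slot p x c ->
  (eval s (precedes A) != 0) = before (best_hit p) c o.
Proof.
move=> ps r4 eo tc to fc r6 r7; rewrite /= r4 r6 r7 !addn1.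
case: o eo to => [b|] /=; last by move=> ->.
case=> [r' [x' [fb -> -> -> _]]] /(_ b erefl) tb.
rewrite (best_hit_lt ps tc tb fc fb) /=.
by case: (r < r'); case: (r == r'); case: (best_slot _ _ _ < _).
Qed.

Definition other_cells p s s' := forall v A, v != p -> cell s' A (code v) = cell s A (code v).

Lemma insert_entry_wp s p o1 o2 c r x : p \notin sinks G ->
  reg s 3 = code (arc_head c) -> reg s 4 = code p ->
  entry Afirst s p o1 -> entry Asecond s p o2 ->
  arc_tail c = p -> (forall b, o1 = Some b -> arc_tail b = p) ->
  (forall b, o2 = Some b -> arc_tail b = p) ->
  best_outcome p (arc_head c) = Some (r, x) -> reg s 6 = r -> reg s 7 = best_slot p x c ->
  reg s 8 = x ->
  wp insert_entry (fun s' => [/\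
    entry Afirst s' p (if before (best_hit p) c o1 then Some c else o1),
    entry Asecond s' p (if before (best_hit p) c o1 then o1
                        else if before (best_hit p) c o2 then Some c else o2)
    & other_cells p s s']) s.
Proof.
move=> ps r3 r4 e1 e2 tc to1 to2 fc r6 r7 r8.
apply: wp_if => [|/eqP].
  rewrite (precedesE ps r4 e1 tc to1 fc r6 r7) => b1; rewrite b1.
  rewrite /= /set_cell /= /upd /= r3 r4 r6 r7 r8 addn1; split.
  - by exists r, x; rewrite /= !eqxx.
  - case: o1 e1 {b1 to1} => [b [r' [x' [fb c1 c2 c3 c4]]]|c1] /=; last by rewrite eqxx.
    by exists r', x'; rewrite /= !eqxx.
  - move=> v A vp /=; have nE : code v == code p = false by rewrite code_eq (negPf vp).
    by do 8!(case: eqP => [->|_]; rewrite ?nE //=).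
rewrite -[_ == 0]negbK (precedesE ps r4 e1 tc to1 fc r6 r7) => nb1; rewrite (negPf nb1).
apply: wp_if => [|/eqP].
  rewrite (precedesE ps r4 e2 tc to2 fc r6 r7) => b2; rewrite b2.
  rewrite /= /set_cell /= /upd /= r3 r4 r6 r7 r8 addn1; split.
  - by case: o1 e1 {to1 nb1}.
  - by exists r, x; rewrite /= !eqxx.
  - move=> v A vp /=; have nE : code v == code p = false by rewrite code_eq (negPf vp).
    by do 4!(case: eqP => [->|_]; rewrite ?nE //=).
by rewrite -[_ == 0]negbK (precedesE ps r4 e2 tc to2 fc r6 r7) => nb2; rewrite (negPf nb2).
Qed.

Lemma top2_tail v S o1 o2 : top2 (best_hit v) (received v S) o1 o2 ->
  (forall b, o1 = Some b -> arc_tail b = v) /\ (forall b, o2 = Some b -> arc_tail b = v).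
Proof.
case=> t1 t2; split=> b E; rewrite E /= in t1 t2.
  by case: t1 => /and3P[/eqP].
by case: t2 => /andP[/and3P[/eqP]].
Qed.

Lemma insert_message_wp S s v p : tables s -> tops S s -> sendable S (v, p) ->
  reg s 3 = code v -> reg s 4 = code p -> message s (best_outcome p v) ->
  wp insert_message (tops (rcons S (v, p))) s.
Proof.
move=> tb tp sd r3 r4 mes; have [vp _ nin] := sd; have ins := tables_input tb.
apply: (wp_seq (Q1 := fun s' => reg s' 9 = arc_index p v)).
  rewrite /= r3 r4 (tables_mult tb) ?(tables_arc tb) //.
  by apply: ltnW; apply: code_lt.
move=> s2 f2 r9; have [fr2 fc2] := f2.
have tb2 : tables s2 by apply: tables_frame f2 tb.
have tp2 : tops S s2.
  move=> w ws; have [o1 [o2 [t2 e1 e2]]] := tp w ws; exists o1, o2; split=> //.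
    by apply: entry_same e1 => i _; rewrite fc2.
  by apply: entry_same e2 => i _; rewrite fc2.
have skip s' : other_cells p s2 s' -> (p \notin sinks G -> exists o1 o2,
    [/\ top2 (best_hit p) (received p (rcons S (v, p))) o1 o2, entry Afirst s' p o1 & entry Asecond s' p o2]) ->
    tops (rcons S (v, p)) s'.
  move=> oc H w; case: (eqVneq w p) => [->|wp ws]; first exact: H.
  have [o1 [o2 [t2 e1 e2]]] := tp2 w ws; exists o1, o2; split.
  - by apply: eq_top2 t2 => c; rewrite received_other.
  - by apply: entry_same e1 => i _; rewrite oc.
  - by apply: entry_same e2 => i _; rewrite oc.
have useless : (if arc_to p v is Some _ then best_outcome p v = None else True) -> tops (rcons S (v, p)) s2.
  move=> U; apply: skip => // ps; have [o1 [o2 [t2 e1 e2]]] := tp2 p ps; exists o1, o2; split=> //.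
  by apply: eq_top2 t2 => c; rewrite received_useless.
have ins2 := tables_input tb2.
have r23 : reg s2 3 = code v by rewrite fr2.
have r24 : reg s2 4 = code p by rewrite fr2.
have evk i : eval s2 (IsEq (Cell Akind (Reg 4)) (Const i)) = (vertex_kind p == i).
  by rewrite /= r24 (input_kind ins2).
apply: wp_if; rewrite evk vertex_kind2 ?neq0_bool.
  by move=> ps; apply: skip => //; rewrite ps.
move/eqP; rewrite eqb0 => ps.
have [o1 [o2 [t2 e1 e2]]] := tp2 p ps; have [to1 to2] := top2_tail t2.
have ev5 : eval s2 (IsEq (Reg 5) (Const 0)) = (reg s 5 == 0) by rewrite /= fr2.
apply: wp_if; rewrite ev5 ?neq0_bool.
  move=> r5; apply: useless; case: arc_to => // _.
  by case: (best_outcome p v) mes => [[r x]|] //= [r5n _ _]; rewrite r5 in r5n.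
move/eqP; rewrite eqb0 => r5.
case fv: (best_outcome p v) mes => [[r x]|]; rewrite /message; last by move=> r50; rewrite r50 in r5.
case=> _ r6 r8.
have ev9 : eval s2 (IsEq (Reg 9) (Const 0)) = (arc_index p v == 0) by rewrite /= r9.
apply: wp_if; rewrite ev9 ?neq0_bool /arc_index.
  by case Eto: (arc_to p v) => [c|] // _; apply: useless; rewrite Eto.
case Eto: (arc_to p v) => [c|] // _; have [tc hc] := arc_toP Eto.
have fc : best_outcome p (arc_head c) = Some (r, x) by rewrite hc.
apply: (wp_seq (Q1 := fun s' => reg s' 7 = best_slot p x c)).
  apply: wp_if; rewrite evk vertex_kind0 ?neq0_bool.
    move=> pr; rewrite /= /upd /= r9 /arc_index Eto subn1 /= (tables_slot tb2) ?tc //.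
    have [a _ rot] := Vr_rotor pr.
    by rewrite /initial_slot /best_slot tc !(slot_rotor rot).
  move/eqP; rewrite eqb0 => pr; have [[pm _]|[]] := vertex_cases ps; last by rewrite (negPf pr).
  by rewrite /= /upd /= fr2 // r8 /best_slot /slot pm; case: (x).
move=> s3 f3 r7; have [fr3 fc3] := f3.
have e13 : entry Afirst s3 p o1 by apply: entry_same e1 => i _; rewrite fc3.
have e23 : entry Asecond s3 p o2 by apply: entry_same e2 => i _; rewrite fc3.
have r33 : reg s3 3 = code (arc_head c) by rewrite hc fr3.
have r34 : reg s3 4 = code p by rewrite fr3.
have r36 : reg s3 6 = r by rewrite fr3 // fr2.
have r38 : reg s3 8 = x by rewrite fr3 // fr2.
apply: wp_mono (insert_entry_wp ps r33 r34 e13 e23 tc to1 to2 fc r36 r7 r38) => s4 [e14 e24 oc].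
apply: skip => [w A wp|_]; first by rewrite oc // fc3.
exists (if before (best_hit p) c o1 then Some c else o1),
  (if before (best_hit p) c o1 then o1 else if before (best_hit p) c o2 then Some c else o2).
split=> //; apply: (top2_insert t2); first exact: received_notin Eto nin.
by apply: received_new => //; rewrite fv.
Qed.

End Exchange.

(** The second half of the schedule is not stored: step i reads entry 2 * l - 1 - i of the first
    half, of length l, with the two ends exchanged. *)
Definition exchange_body :=
  Seq (If (Lt (Reg 2) (Reg 10))
          (Seq (Assign 3 (Cell Asrc (Reg 2))) (Assign 4 (Cell Adst (Reg 2))))
          (Seq (Assign 11 (Minus (Minus (Plus (Reg 10) (Reg 10)) (Const 1)) (Reg 2)))
          (Seq (Assign 3 (Cell Adst (Reg 11))) (Assign 4 (Cell Asrc (Reg 11))))))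
 (Seq compute_message (Seq insert_message (Incr 2))).

Definition exchange_test := Lt (Reg 2) (Plus (Reg 10) (Reg 10)).

Definition exchange_loop := Seq (Assign 2 (Const 0)) (While exchange_test exchange_body).

Definition output_body :=
  Seq (If (IsEq (Cell Akind (Reg 2)) (Const 2))
          (Store output_array (Reg 2) (Cell Avalue (Reg 2)))
          (Store output_array (Reg 2) (Cell Afirst.+3 (Reg 2))))
      (Incr 2).

Definition output_loop := Seq (Assign 2 (Const 0)) (While (Lt (Reg 2) (Reg 0)) output_body).

Section ExchangeLoop.
Variable G : rotor_game.
Hypothesis treeG : tree_like G.
Hypothesis stopG : stopping G.
Hypothesis simple : simple_digraph G.
Hypothesis binary : binary_values G.
Implicit Types (u v w p : vertex G) (a b c : arcs G) (s : state).

Local Notation n := #|vertex G|.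

Lemma size_schedule (L : seq (vertex G * vertex G)) : size (schedule L) = size L + size L.
Proof. by rewrite size_cat size_rev size_map. Qed.

Lemma nth_schedule x0 (L : seq (vertex G * vertex G)) i : size L <= i < size L + size L ->
  nth x0 (schedule L) i = swap (nth x0 L (size L + size L - 1 - i)).
Proof.
case/andP=> lo hi; rewrite nth_cat ltnNge lo /= nth_rev size_map; last first.
  by move: lo hi; clear; lia.
rewrite (nth_map x0); last by move: lo hi; clear; lia.
by congr (swap (nth _ _ _)); move: lo hi; clear; lia.
Qed.

Lemma exchange_halts s L : tables G s -> peeled s L -> zeros Afirst s -> zeros Asecond s ->
  (forall u v, adj u v -> (u, v) \in L \/ (v, u) \in L) ->
  halts exchange_loop s ((n + n).+1 * loop_cost (Assign 2 (Const 0)) exchange_test exchange_body)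
    (tops (schedule L)).
Proof.
move=> tb pl z1 z2 full; set S := schedule L.
have [u0 _] := set0Pn _ (sinks_neq0 G); pose x0 := (u0, u0).
have uL : uniq L by apply: map_uniq (peeled_uniq pl).
have ordS : in_order (@sendable G) S.
  exact: schedule_order (peeled_order pl) uL (peeled_anti pl) full.
pose I k s' := exists i, [/\ reg s' 2 = i, k = size S - i, i <= size S & tops (take i S) s'].
have I0 : wp (Assign 2 (Const 0)) (I (size S)) s.
  exists 0; split=> //; first by rewrite subn0.
  move=> v vs; exists None, None; rewrite take0; split; last 2 first.
  - exact: z1.
  - exact: z2.
  by split=> c; rewrite /received /= ?andbF.
apply: halts_mono (halts_loop I0 _) _ _ => [k s1 f1 [i [r2 -> lei tp]]||s1 f1 [[k [i [r2 _ lei tp]]]]].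
- have [fr1 fc1] := f1; have tb1 : tables G s1 by apply: tables_frame f1 tb.
  have r10 : reg s1 10 = size L by rewrite fr1 // (peeled_size pl).
  rewrite eval_Lt neq0_bool /eval r2 r10 -size_schedule -/S => lt.
  have Snth : take i.+1 S = rcons (take i S) (nth x0 S i) by rewrite (take_nth x0).
  have sd : sendable (take i S) (nth x0 S i).
    by apply: (ordS _ _ (drop i.+1 S)); rewrite -drop_nth // cat_take_drop.
  have src j : j < size L -> cell s1 Asrc j = code (nth x0 L j).1.
    by move=> lj; rewrite fc1 // (peeled_src pl) ?size_map // (nth_map x0).
  have dst j : j < size L -> cell s1 Adst j = code (nth x0 L j).2.
    by move=> lj; rewrite fc1 // (peeled_dst pl) ?size_map // (nth_map x0).
  apply: (wp_seq (Q1 := fun s' => reg s' 3 = code (nth x0 S i).1 /\ reg s' 4 = code (nth x0 S i).2)).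
    apply: wp_if; rewrite eval_Lt /eval r2 r10 ?neq0_bool.
      by move=> li; rewrite /= /upd /= r2 src // dst // /S /schedule nth_cat li.
    move/eqP; rewrite eqb0 -leqNgt => li; rewrite /= /upd /= r2 r10.
    rewrite size_schedule in lt; rewrite nth_schedule ?li //.
    have lj : size L + size L - 1 - i < size L by move: li lt; clear; lia.
    by rewrite src // dst.
  move: sd Snth; case: (nth x0 S i) => v p sd Snth s2 f2 [r3 r4]; have [fr2 fc2] := f2.
  have tb2 : tables G s2 by apply: tables_frame f2 tb1.
  have tp2 : tops (take i S) s2.
    move=> w ws; have [o1 [o2 [t2 e1 e2]]] := tp w ws; exists o1, o2; split=> //.
      by apply: entry_same e1 => j _; rewrite fc2.
    by apply: entry_same e2 => j _; rewrite fc2.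
  apply: (wp_seq (compute_message_wp treeG simple binary tb2 tp2 sd r3 r4)).
  move=> s3 f3 mes; have [fr3 fc3] := f3.
  have tb3 : tables G s3 by apply: tables_frame f3 tb2.
  have tp3 : tops (take i S) s3.
    move=> w ws; have [o1 [o2 [t2 e1 e2]]] := tp2 w ws; exists o1, o2; split=> //.
      by apply: entry_same e1 => j _; rewrite fc3.
    by apply: entry_same e2 => j _; rewrite fc3.
  have r33 : reg s3 3 = code v by rewrite fr3.
  have r34 : reg s3 4 = code p by rewrite fr3.
  apply: (wp_seq (insert_message_wp simple tb3 tp3 sd r33 r34 mes)).
  move=> s4 [fr4 fc4] tp4; exists (size S - i.+1); first exact: ltn_subS.
  exists i.+1; rewrite Snth /= /upd /= fr4 // fr3 // fr2 // r2 addn1; split=> //.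
- rewrite leq_mul2r ltnS size_schedule; apply/orP; right.
  by apply: leq_add; apply: peeled_card pl.
- have [fr1 fc1] := f1.
  have r10 : reg s1 10 = size L by rewrite fr1 // (peeled_size pl).
  rewrite eval_Lt /= r2 r10 -size_schedule -/S => /eqP; rewrite eqb0 -leqNgt => ge.
  by move: tp; rewrite take_oversize.
Qed.

(** Once every neighbour has sent, the events received at [u] are those of the root instance of
    [node], so the value of the first entry is the answer. *)
Lemma full_tops_optimal S s u r x o1 o2 : u \notin sinks G ->
  (forall v w, adj v w -> (v, w) \in S) ->
  top2 (best_hit u) (received u S) o1 o2 -> entry Afirst s u o1 ->
  node (@win G) (Vmax G) (rho0 G) u u (best_outcome u) = Some (r, x) ->
  cell s Afirst.+3 (code u) = x.
Proof.
move=> us full [t1 _] e1; rewrite (node_first_of (o := o1)) //.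
  case: o1 e1 {t1} => [b|] //= [r' [x' [E _ _ _ ->]]]; rewrite E.
  by case=> _ ->.
apply: eq_first_of t1 => c; rewrite /received /event /=; case: eqP => //= tc.
have uc := adj_head tc; rewrite full /=; last by rewrite adj_sym.
by have -> : arc_head c != u by apply: contraTneq uc => ->; rewrite adj_irr.
Qed.

Lemma output_halts s S : input G s -> tops S s -> (forall v w, adj v w -> (v, w) \in S) ->
  halts output_loop s (n.+1 * loop_cost (Assign 2 (Const 0)) (Lt (Reg 2) (Reg 0)) output_body)
    (fun s' => forall u, optimal_value u (output s' u)).
Proof.
move=> ins tp full.
pose I k s' := exists i, [/\ reg s' 2 = i, k = n - i &
  forall u, code u < i -> optimal_value u (cell s' output_array (code u))].
have I0 : wp (Assign 2 (Const 0)) (I n) s by exists 0; split; rewrite ?subn0.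
apply: halts_mono (halts_loop I0 _) _ _ => // [k s1 f1 [i [r2 -> opt]]|s1 f1 [[k [i [r2 _ opt]]]]];
  have in1 : input G s1 by apply: input_frame f1 ins.
2: {
  rewrite eval_Lt /= r2 (input_n in1) => /eqP; rewrite eqb0 -leqNgt => ge u.
  by apply: opt; apply: leq_trans ge; apply: code_lt.
}
rewrite eval_Lt neq0_bool /eval r2 (input_n in1) => /code_ex[u uE]; rewrite -uE in r2 opt *.
have [r [x [nE ox]]] := optimal_outcome treeG stopG simple binary u.
have [fr1 fc1] := f1.
apply: (wp_seq (Q1 := fun s' => cell s' output_array (code u) = x /\
    forall v, v != u -> cell s' output_array (code v) = cell s1 output_array (code v))).
  have ev : eval s1 (IsEq (Cell Akind (Reg 2)) (Const 2)) = (u \in sinks G).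
    by rewrite /= r2 (input_kind in1) vertex_kind2.
  have oc v y : v != u -> upd (cell s1 output_array) (code u) y (code v) = cell s1 output_array (code v).
    by move=> vu; rewrite /upd code_eq (negPf vu).
  apply: wp_if; rewrite ev ?neq0_bool.
    move=> us; rewrite /= r2 (input_value in1) /vertex_value us sink_value //.
    move: nE; rewrite /node us => -[_ <-]; rewrite /upd /= eqxx; split=> // v vu.
    exact: oc.
  move/eqP; rewrite eqb0 => us; rewrite /= r2; have [o1 [o2 [t2 e1 _]]] := tp u us.
  have -> : cell s1 Afirst.+3 (code u) = x by rewrite fc1 // (full_tops_optimal us full t2 e1 nE).
  rewrite /upd /= eqxx; split=> // v vu.
  exact: oc.
move=> s2 [fr2 fc2] [cu cv]; exists (n - (code u).+1); first by apply: ltn_subS; apply: code_lt.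
exists (code u).+1; rewrite /= /upd /= fr2 // r2 addn1; split=> // v.
rewrite ltnS leq_eqVlt code_eq; case: eqVneq => [-> _|vu /=]; first by rewrite cu.
by move=> lt; rewrite cv //; apply: opt.
Qed.

End ExchangeLoop.

Definition program :=
  Seq multiples_loop (Seq load_loop (Seq number_loop (Seq peel_loop (Seq exchange_loop output_loop)))).

(** The factors absorb the [.+1] of each round count, using n > 0 and m <= 2 * n: n + 1 <= 2n, m + 1
    <= 3n, n + m + 1 <= 4n and 2n + 1 <= 3n. *)
Definition program_cost :=
  2 * loop_cost (Assign 2 (Const 0)) (Lt (Reg 2) (Reg 0)) multiples_body +
  (3 * loop_cost (Assign 2 (Const 0)) (Lt (Reg 2) (Reg 1)) load_body +
  (4 * loop_cost number_init (Lt (Reg 2) (Reg 0)) number_body +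
  (3 * loop_cost peel_init (Lt (Reg 2) (Reg 0)) peel_body +
  (3 * loop_cost (Assign 2 (Const 0)) exchange_test exchange_body +
   2 * loop_cost (Assign 2 (Const 0)) (Lt (Reg 2) (Reg 0)) output_body)))).

Lemma program_halts (G : rotor_game) : tree_like G -> stopping G -> simple_digraph G ->
  binary_values G ->
  halts program (input_state G) (program_cost * #|vertex G|)
    (fun s => forall u : vertex G, optimal_value u (output s u)).
Proof.
move=> treeG stopG simple binary; have [u0 _] := set0Pn _ (sinks_neq0 G).
have n0 : 0 < #|vertex G| by apply: leq_ltn_trans (code_lt u0).
have mn := card_arcs treeG simple; have in0 := input_input_state G.
have scale k j D : j <= k * #|vertex G| -> j * D <= k * D * #|vertex G|.
  by move=> le; rewrite -mulnA [D * _]mulnC mulnA leq_mul2r le orbT.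
rewrite /program_cost !mulnDl.
apply: halts_seq.
  apply: halts_mono (multiples_halts in0 _) (scale _ _ _ _) _ => [//||s f m]; last exact: m.
  by move: n0; clear; lia.
move=> s1 f1 mul1; have in1 : input G s1 by apply: input_frame f1 in0.
have [_ c1] := f1.
apply: halts_seq.
  apply: halts_mono (load_halts simple in1 mul1 _ _ _) (scale _ _ _ _) _ => [||||s f H]; last exact: H.
  - by move=> i; rewrite c1.
  - by move=> i; rewrite c1.
  - by move=> i; rewrite c1.
  - by move: n0 mn; clear; lia.
move=> s2 f2 [arc2 deg2]; have in2 : input G s2 by apply: input_frame f2 in1.
have [_ c2] := f2.
apply: halts_seq.
  apply: halts_mono (number_halts in2 _) (scale _ _ _ _) _ => [||s f H]; last exact: H.
  - by move=> i; rewrite c2 // c1.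
  - by move: n0 mn; clear; lia.
move=> s3 f3 slot3; have in3 : input G s3 by apply: input_frame f3 in2.
have [_ c3] := f3.
apply: halts_seq.
  apply: halts_mono (peel_halts treeG in3 _) (scale _ _ _ _) _ => [||s f H]; last exact: H.
  - by case: deg2 => d1 d2; split=> u; rewrite c3.
  - by move: n0 mn; clear; lia.
move=> s4 f4 [L [peel4 full]]; have in4 : input G s4 by apply: input_frame f4 in3.
have [_ c4] := f4.
have tb4 : tables G s4.
  split=> // [i le|u v|a ta].
  - by rewrite c4 // c3 // c2 // mul1.
  - by rewrite c4 // c3 // arc2.
  - by rewrite c4 // slot3.
apply: halts_seq.
  apply: halts_mono (exchange_halts treeG simple binary tb4 peel4 _ _ full) (scale _ _ _ _) _ => [|||s f H]; last exact: H.
  - by move=> i; rewrite c4 // c3 // c2 // c1.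
  - by move=> i; rewrite c4 // c3 // c2 // c1.
  - by move: n0; clear; lia.
move=> s5 f5 tops5; have in5 : input G s5 by apply: input_frame f5 in4.
apply: halts_mono (output_halts treeG stopG simple binary in5 tops5 (schedule_full full)) (scale _ _ _ _) _ => [|s f H]; last exact: H.
by move: n0; clear; lia.
Qed.

Theorem theorem67 :
  exists (prog : cmd) (C : nat),
  forall G : rotor_game,
    tree_like G -> stopping G -> simple_digraph G -> binary_values G ->
    exists (t : nat) (s : state),
      [/\ exec prog (input_state G) t s,
          t <= C * #|vertex G|
        & forall u : vertex G, optimal_value u (output s u)].
Proof.
exists program, program_cost => G treeG stopG simple binary.
exact: program_halts.
Qed.
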